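(* Let $\mathfrak M_1$ be the Farey AF algebra and $E(\mathfrak M_1)=(E(\mathfrak M_1),0,{}^*,\oplus)$ its Elliott involutive monoid. Then: (a) $E(\mathfrak M_1)$ is singly generated (as an involutive monoid, i.e. as an algebra with operations $0,{}^*,\oplus$). (b) For any two generators $[p]$ and $[q]$ of $E(\mathfrak M_1)$, the map $[p]\mapsto[q]$ extends uniquely to an automorphism of $E(\mathfrak M_1)$. (c) If $[p]$ is a generator of $E(\mathfrak M_1)$, then the only other generator is $[1_{\mathfrak M_1}-p]$.
   Context: An AF algebra is the norm closure of the union of an ascending sequence of finite-dimensional C*-algebras all having the same unit. An AF$\ell$ algebra is an AF algebra whose Murray–von Neumann order on equivalence classes of projections is a lattice. For an AF$\ell$ algebra $\mathfrak B$, the Elliott involutive monoid $E(\mathfrak B)=(E(\mathfrak B),0,{}^*,\oplus)$ is the set of Murray–von Neumann equivalence classes $[p]$ of projections of $\mathfrak B$, with $\oplus$ the unique associative, commutative, monotone extension of Elliott's partial addition ($[p]+[q]=[p+q]$ for orthogonal $p,q$) such that $[1_{\mathfrak B}-p]$ is the least $[q]$ with $[p]+[q]=[1_{\mathfrak B}]$, and with involution $[p]^*=[1_{\mathfrak B}-p]$. Equivalently, $E(\mathfrak B)$ is isomorphic to the unit interval $[0,u]$ of the unital lattice-ordered group $(K_0(\mathfrak B),u=[1_{\mathfrak B}])$ with $x^*=u-x$ and $x\oplus y=(x+y)\wedge u$. Let $M_1$ be the unital lattice-ordered abelian group of all continuous piecewise linear functions $f:[0,1]\to\mathbb R$ with finitely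 many linear pieces, each having integer coefficients, with pointwise operations and distinguished unit the constant function $1$. The Farey AF algebra $\mathfrak M_1$ is the (unique up to isomorphism) AF algebra whose unital ordered $K_0$-group is isomorphic to $(M_1,1)$; it is an AF$\ell$ algebra. *)

(* Defs.v *)
From HB Require Import structures.
From mathcomp Require Import all_boot all_order all_algebra generic_quotient.
From mathcomp Require Import complex.
From mathcomp Require Import all_classical all_reals all_analysis.

Set Implicit Arguments.
Unset Strict Implicit.
Unset Printing Implicit Defensive.

Import Order.TTheory GRing.Theory Num.Theory.
Import numFieldNormedType.Exports.

Local Open Scope classical_set_scope.
Local Open Scope complex_scope.
Local Open Scope ring_scope.
Local Open Scope quotient_scope.

(* The norm is kept as a function to R: the library's normed modules cannot be
   joined with its non-commutative rings in the Hierarchy-Builder hierarchy. *)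
HB.mixin Record isCStarAlgebra (R : realType) A of GRing.Algebra R[i] A := {
  cstar : A -> A;
  cnorm : A -> R;
  cstarK : involutive cstar;
  cstarD : {morph cstar : a b / a + b};
  cstarZ : forall (c : R[i]) (a : A), cstar (c *: a) = Num.conj c *: cstar a;
  cstarM : forall a b : A, cstar (a * b) = cstar b * cstar a;
  cnorm_eq0 : forall a : A, cnorm a = 0 -> a = 0;
  cnormD : forall a b : A, cnorm (a + b) <= cnorm a + cnorm b;
  cnormZ : forall (c : R[i]) (a : A), cnorm (c *: a) = Normc.normc c * cnorm a;
  cnormM : forall a b : A, cnorm (a * b) <= cnorm a * cnorm b;
  cnorm_star : forall a : A, cnorm (cstar a * a) = cnorm a ^+ 2;
  cnorm_complete : forall u : nat -> A,
    (forall e : R, 0 < e ->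
      exists N, forall m n, (N <= m)%N -> (N <= n)%N -> cnorm (u m - u n) < e) ->
    exists l, forall e : R, 0 < e ->
      exists N, forall n, (N <= n)%N -> cnorm (u n - l) < e
}.

#[short(type="cstarAlgType")]
HB.structure Definition CStarAlgebra (R : realType) :=
  {A of GRing.Algebra R[i] A & isCStarAlgebra R A}.

Section AF.
Context {R : realType} (A : cstarAlgType R).

(* A finite-dimensional linear subspace is automatically norm closed, so this
   is a finite-dimensional C*-subalgebra with the unit of A. *)
Definition fd_cstar_subalg (F : set A) : Prop :=
  [/\ F 1,
      forall a b, F a -> F b -> F (a * b),
      forall a, F a -> F (cstar a) &
      exists (n : nat) (e : 'I_n -> A),
        F = [set \sum_(i < n) c i *: e i | c in [set: 'I_n -> R[i]]]].

Definition is_AF : Prop :=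
  exists F : nat -> set A,
    [/\ forall k, fd_cstar_subalg (F k),
        forall k, F k `<=` F k.+1 &
        forall (a : A) (e : R), 0 < e ->
          exists2 b, (\bigcup_k F k) b & cnorm (a - b) < e].

End AF.

Section Projections.
Context {R : realType} (A : cstarAlgType R).

Record projection := Projection {
  pr_val :> A;
  pr_star : cstar pr_val = pr_val;
  pr_idem : pr_val * pr_val = pr_val
}.

Lemma cstar0 : cstar (0 : A) = 0.
Proof. by apply: (addrI (cstar 0)); rewrite -cstarD !addr0. Qed.

Lemma cstarN (a : A) : cstar (- a) = - cstar a.
Proof. by apply: (addrI (cstar a)); rewrite -cstarD !subrr cstar0. Qed.

Lemma cstar1 : cstar (1 : A) = 1.
Proof. by rewrite -[LHS]mulr1 -[1 in X in _ * X]cstarK -cstarM mulr1 cstarK. Qed.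

Lemma pr0_idem : 0 * 0 = 0 :> A. Proof. by rewrite mul0r. Qed.

Definition pr0 : projection := Projection cstar0 pr0_idem.

Lemma prC_star (p : projection) : cstar (1 - (p : A)) = 1 - (p : A).
Proof. by rewrite cstarD cstarN cstar1 pr_star. Qed.

Lemma prC_idem (p : projection) : (1 - (p : A)) * (1 - (p : A)) = 1 - (p : A).
Proof. by rewrite mulrBl mul1r mulrBr mulr1 pr_idem subrr subr0. Qed.

Definition prC (p : projection) : projection :=
  Projection (prC_star p) (prC_idem p).

Definition mvn_eq (p q : projection) : Prop :=
  exists v : A, cstar v * v = p :> A /\ v * cstar v = q :> A.

Lemma mvn_refl p : mvn_eq p p.
Proof. by exists p; rewrite pr_star pr_idem. Qed.

Lemma mvn_sym p q : mvn_eq p q -> mvn_eq q p.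
Proof. by move=> [v [h1 h2]]; exists (cstar v); rewrite cstarK. Qed.

Lemma mvn_trans q p r : mvn_eq p q -> mvn_eq q r -> mvn_eq p r.
Proof.
move=> [v [vp vq]] [w [wq wr]]; exists (w * v); rewrite !cstarM; split.
  by rewrite mulrA -(mulrA (cstar v)) wq -vq -!mulrA vp mulrA vp pr_idem.
by rewrite mulrA -(mulrA w) vq -wq -!mulrA wr mulrA wr pr_idem.
Qed.

HB.instance Definition _ := gen_eqMixin projection.
HB.instance Definition _ := gen_choiceMixin projection.

Definition mvn_rel : rel projection := fun p q => `[< mvn_eq p q >].

Lemma mvn_rel_refl : reflexive mvn_rel.
Proof. by move=> p; apply/asboolP; exact: mvn_refl. Qed.

Lemma mvn_rel_sym : symmetric mvn_rel.
Proof. by move=> p q; apply/asboolP/asboolP; exact: mvn_sym. Qed.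

Lemma mvn_rel_trans : transitive mvn_rel.
Proof.
by move=> q p r /asboolP pq /asboolP qr; apply/asboolP; exact: mvn_trans pq qr.
Qed.

Canonical mvn_equiv := EquivRel mvn_rel mvn_rel_refl mvn_rel_sym mvn_rel_trans.

Definition elliott := {eq_quot mvn_equiv}.
HB.instance Definition _ := Choice.on elliott.

Definition mvn_class (p : projection) : elliott := \pi_elliott p.

Definition elliott0 : elliott := mvn_class pr0.

(* [p]^* = [1 - p]. In an AF algebra [1 - p] only depends on [p]. *)
Definition elliottC (x : elliott) : elliott := mvn_class (prC (repr x)).

(* [p] <= [q] iff p is equivalent to a subprojection of q. *)
Definition elliott_le (x y : elliott) : Prop :=
  exists p q : projection,
    [/\ mvn_class p = x, mvn_class q = y & (q : A) * (p : A) = p :> A].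

(* The conditions characterizing the sum of the Elliott monoid; the fourth one
   says that it extends Elliott's partial addition, and the last two that
   [1 - p] is the least [q] such that [p] + [q] = [1]. *)
Definition is_elliott_sum (op : elliott -> elliott -> elliott) : Prop :=
  [/\ associative op,
      commutative op,
      forall x y z, elliott_le x y -> elliott_le (op x z) (op y z),
      forall p q r : projection,
        (p : A) * (q : A) = 0 -> (r : A) = (p : A) + (q : A) ->
        op (mvn_class p) (mvn_class q) = mvn_class r &
      forall p : projection,
        op (mvn_class p) (mvn_class (prC p)) = mvn_class (prC pr0) /\
        forall y, op (mvn_class p) y = mvn_class (prC pr0) ->
          elliott_le (mvn_class (prC p)) y].

(* The sum is the operation satisfying the above (it exists and is unique when
   A is an AF algebra whose Murray-von Neumann order is a lattice). *)
Definition elliottD : elliott -> elliott -> elliott :=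
  xget (fun _ _ => elliott0) is_elliott_sum.

Definition elliott_closed (S : set elliott) : Prop :=
  [/\ S elliott0,
      forall x, S x -> S (elliottC x) &
      forall x y, S x -> S y -> S (elliottD x y)].

Definition elliott_generator (g : elliott) : Prop :=
  forall S : set elliott, elliott_closed S -> S g -> S = [set: elliott].

Definition elliott_automorphism (f : elliott -> elliott) : Prop :=
  [/\ bijective f,
      f elliott0 = elliott0,
      {morph f : x / elliottC x} &
      {morph f : x y / elliottD x y}].

End Projections.

Section Grothendieck.
Variable V : nmodType.

Definition groth_rel : rel (V * V) := fun x y =>
  `[< exists r, x.1 + y.2 + r = y.1 + x.2 + r >].

Lemma groth_refl : reflexive groth_rel.
Proof. by move=> x; apply/asboolP; exists 0. Qed.

Lemma groth_sym : symmetric groth_rel.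
Proof. by move=> x y; apply/asboolP/asboolP => -[r h]; exists r. Qed.

Lemma groth_trans : transitive groth_rel.
Proof.
move=> y x z /asboolP[r h] /asboolP[s k]; apply/asboolP.
exists (y.1 + y.2 + r + s).
rewrite [LHS](AC (2*4) ((1*4*5)*(3*2*6))) /= h k.
by rewrite [LHS](AC (3*3) ((4*2)*(1*5*3*6))).
Qed.

Canonical groth_equiv := EquivRel groth_rel groth_refl groth_sym groth_trans.

Definition groth := {eq_quot groth_equiv}.
HB.instance Definition _ := Choice.on groth.

Definition groth_pair (a b : V) : groth := \pi_groth (a, b).

Lemma groth_pairP (a b c d : V) :
  groth_pair a b = groth_pair c d <-> exists r, a + d + r = c + b + r.
Proof. by split => [/eqquotP/asboolP//|h]; apply/eqquotP/asboolP. Qed.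

Lemma groth_pair_ind (P : groth -> Prop) :
  (forall a b, P (groth_pair a b)) -> forall x, P x.
Proof. by move=> h x; rewrite -(reprK x); case: (repr x) => a b; exact: h. Qed.

Definition groth_add (x y : groth) : groth :=
  groth_pair ((repr x).1 + (repr y).1) ((repr x).2 + (repr y).2).

Definition groth_opp (x : groth) : groth := groth_pair (repr x).2 (repr x).1.

Lemma groth_addE a b c d :
  groth_add (groth_pair a b) (groth_pair c d) = groth_pair (a + c) (b + d).
Proof.
rewrite /groth_add.
have := reprK (groth_pair a b); case: (repr _) => a' b' /groth_pairP /= [r h].
have := reprK (groth_pair c d); case: (repr _) => c' d' /groth_pairP /= [s k].
apply/groth_pairP; exists (r + s).
rewrite [LHS](AC (2*2*2) ((1*3*5)*(2*4*6))) /= h k.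
by rewrite [LHS](AC (3*3) ((1*4)*(2*5)*(3*6))).
Qed.

Lemma groth_oppE a b : groth_opp (groth_pair a b) = groth_pair b a.
Proof.
rewrite /groth_opp.
have := reprK (groth_pair a b); case: (repr _) => a' b' /groth_pairP /= [r h].
by apply/groth_pairP; exists r; rewrite (addrC b') (addrC b) h.
Qed.

Lemma groth_addA : associative groth_add.
Proof.
elim/groth_pair_ind => a b; elim/groth_pair_ind => c d.
by elim/groth_pair_ind => e f; rewrite !groth_addE !addrA.
Qed.

Lemma groth_addC : commutative groth_add.
Proof.
elim/groth_pair_ind => a b; elim/groth_pair_ind => c d.
by rewrite !groth_addE (addrC a) (addrC b).
Qed.

Lemma groth_add0 : left_id (groth_pair 0 0) groth_add.
Proof. by elim/groth_pair_ind => a b; rewrite groth_addE !add0r. Qed.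

Lemma groth_addN : left_inverse (groth_pair 0 0) groth_opp groth_add.
Proof.
elim/groth_pair_ind => a b; rewrite groth_oppE groth_addE.
by apply/groth_pairP; exists 0; rewrite add0r !addr0 addrC.
Qed.

HB.instance Definition _ := GRing.isZmodule.Build groth
  groth_addA groth_addC groth_add0 groth_addN.

End Grothendieck.

Section K0.
Context {R : realType} (A : cstarAlgType R).

Definition adjmx m n (M : 'M[A]_(m, n)) : 'M[A]_(n, m) :=
  \matrix_(i, j) cstar (M j i).

Lemma adjmxK m n (M : 'M[A]_(m, n)) : adjmx (adjmx M) = M.
Proof. by apply/matrixP => i j; rewrite !mxE cstarK. Qed.

Lemma adjmx0 m n : adjmx (0 : 'M[A]_(m, n)) = 0.
Proof. by apply/matrixP => i j; rewrite !mxE cstar0. Qed.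

Lemma adjmxM m n k (M : 'M[A]_(m, n)) (N : 'M[A]_(n, k)) :
  adjmx (M *m N) = adjmx N *m adjmx M.
Proof.
apply/matrixP => i j; rewrite !mxE (big_morph _ (@cstarD _ A) (cstar0 A)).
by apply: eq_bigr => l _; rewrite !mxE cstarM.
Qed.

Lemma adjmx_row m n1 n2 (M : 'M[A]_(m, n1)) (N : 'M[A]_(m, n2)) :
  adjmx (row_mx M N) = col_mx (adjmx M) (adjmx N).
Proof. by apply/matrixP => i j; rewrite !mxE; case: (fintype.split i) => k; rewrite mxE. Qed.

Lemma adjmx_col m1 m2 n (M : 'M[A]_(m1, n)) (N : 'M[A]_(m2, n)) :
  adjmx (col_mx M N) = row_mx (adjmx M) (adjmx N).
Proof. by apply/matrixP => i j; rewrite !mxE; case: (fintype.split j) => k; rewrite mxE. Qed.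

Lemma adjmx_block m1 m2 n1 n2 (a : 'M[A]_(m1, n1)) (b : 'M[A]_(m1, n2))
    (c : 'M[A]_(m2, n1)) (d : 'M[A]_(m2, n2)) :
  adjmx (block_mx a b c d)
  = block_mx (adjmx a) (adjmx c) (adjmx b) (adjmx d).
Proof. by rewrite block_mxEv adjmx_col !adjmx_row block_mxEh. Qed.

(* Projections of the matrix algebras over A, of all sizes. *)
Record mxprojection := MxProjection {
  mxpr_size : nat;
  mxpr_val :> 'M[A]_mxpr_size;
  mxpr_adj : adjmx mxpr_val = mxpr_val;
  mxpr_idem : mxpr_val *m mxpr_val = mxpr_val
}.

Definition mxmvn_eq (p q : mxprojection) : Prop :=
  exists v : 'M[A]_(mxpr_size q, mxpr_size p),
    adjmx v *m v = p /\ v *m adjmx v = q.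

Lemma mxmvn_refl p : mxmvn_eq p p.
Proof. by exists p; rewrite mxpr_adj mxpr_idem. Qed.

Lemma mxmvn_sym p q : mxmvn_eq p q -> mxmvn_eq q p.
Proof. by move=> [v [h1 h2]]; exists (adjmx v); rewrite adjmxK. Qed.

Lemma mxmvn_trans q p r : mxmvn_eq p q -> mxmvn_eq q r -> mxmvn_eq p r.
Proof.
move=> [v [vp vq]] [w [wq wr]]; exists (w *m v); rewrite !adjmxM; split.
  rewrite mulmxA -(mulmxA (adjmx v)) wq -vq -!mulmxA vp mulmxA vp.
  by rewrite mxpr_idem.
by rewrite mulmxA -(mulmxA w) vq -wq -!mulmxA wr mulmxA wr mxpr_idem.
Qed.

HB.instance Definition _ := gen_eqMixin mxprojection.
HB.instance Definition _ := gen_choiceMixin mxprojection.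

Definition mxmvn_rel : rel mxprojection := fun p q => `[< mxmvn_eq p q >].

Lemma mxmvn_rel_refl : reflexive mxmvn_rel.
Proof. by move=> p; apply/asboolP; exact: mxmvn_refl. Qed.

Lemma mxmvn_rel_sym : symmetric mxmvn_rel.
Proof. by move=> p q; apply/asboolP/asboolP; exact: mxmvn_sym. Qed.

Lemma mxmvn_rel_trans : transitive mxmvn_rel.
Proof.
move=> q p r /asboolP pq /asboolP qr; apply/asboolP.
exact: mxmvn_trans pq qr.
Qed.

Canonical mxmvn_equiv :=
  EquivRel mxmvn_rel mxmvn_rel_refl mxmvn_rel_sym mxmvn_rel_trans.

Definition mvn_monoid := {eq_quot mxmvn_equiv}.
HB.instance Definition _ := Choice.on mvn_monoid.

Definition mxmvn_class (p : mxprojection) : mvn_monoid := \pi_mvn_monoid p.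

Lemma mxmvn_classP p q : mxmvn_class p = mxmvn_class q <-> mxmvn_eq p q.
Proof. by split => [/eqquotP/asboolP//|h]; apply/eqquotP/asboolP. Qed.

Lemma dsum_adj (p q : mxprojection) :
  adjmx (block_mx p 0 0 q) = block_mx p 0 0 q.
Proof. by rewrite adjmx_block !adjmx0 !mxpr_adj. Qed.

Lemma dsum_idem (p q : mxprojection) :
  block_mx p 0 0 q *m block_mx p 0 0 q = block_mx p 0 0 q.
Proof.
by rewrite mulmx_block !mulmx0 !mul0mx !mxpr_idem !addr0 !add0r.
Qed.

Definition dsum (p q : mxprojection) : mxprojection :=
  MxProjection (dsum_adj p q) (dsum_idem p q).

Lemma mxpr00_adj : adjmx (0 : 'M[A]_0) = 0. Proof. exact: adjmx0. Qed.

Lemma mxpr00_idem : (0 : 'M[A]_0) *m (0 : 'M[A]_0) = 0. Proof. exact: mulmx0. Qed.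

Definition mxpr00 : mxprojection := MxProjection mxpr00_adj mxpr00_idem.

Lemma mxpr11_adj : adjmx (1%:M : 'M[A]_1) = 1%:M.
Proof. by apply/matrixP => i j; rewrite !mxE !ord1 eqxx cstar1. Qed.

Lemma mxpr11_idem : (1%:M : 'M[A]_1) *m (1%:M : 'M[A]_1) = 1%:M.
Proof. exact: mulmx1. Qed.

Definition mxpr11 : mxprojection := MxProjection mxpr11_adj mxpr11_idem.

Lemma dsum_mvn p p' q q' :
  mxmvn_eq p p' -> mxmvn_eq q q' -> mxmvn_eq (dsum p q) (dsum p' q').
Proof.
move=> [v [v1 v2]] [w [w1 w2]]; exists (block_mx v 0 0 w).
rewrite adjmx_block !adjmx0 /= !mulmx_block !mulmx0 !mul0mx !addr0 !add0r.
by rewrite v1 v2 w1 w2.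
Qed.

Lemma dsumC p q : mxmvn_eq (dsum p q) (dsum q p).
Proof.
exists (block_mx 0 (mxpr_val q) (mxpr_val p) 0).
rewrite adjmx_block !adjmx0 /= !mulmx_block !mulmx0 !mul0mx !addr0 !add0r.
by rewrite !mxpr_adj !mxpr_idem.
Qed.

Lemma dsum0 p : mxmvn_eq (dsum mxpr00 p) p.
Proof.
exists (row_mx 0 (mxpr_val p)); rewrite adjmx_row adjmx0 mxpr_adj /=.
rewrite mul_col_row mul_row_col !mulmx0 !mul0mx mxpr_idem add0r; split => //.
Qed.

Lemma dsumA p q r : mxmvn_eq (dsum p (dsum q r)) (dsum (dsum p q) r).
Proof.
exists (col_mx (block_mx (mxpr_val p) (row_mx 0 0) 0 (row_mx (mxpr_val q) 0))
               (row_mx 0 (row_mx 0 (mxpr_val r)))).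
rewrite adjmx_col adjmx_block !adjmx_row !adjmx0 !mxpr_adj /=.
rewrite row_mx0 !col_mx0; split.
  rewrite mul_row_col mulmx_block mul_col_row !mul_col_row.
  by rewrite !(mulmx0, mul0mx, mxpr_idem, add_block_mx, addr0, add0r).
rewrite mul_col_row mulmx_block mul_block_col mul_row_block !mul_row_col.
rewrite !(mulmx0, mul0mx, mxpr_idem, addr0, add0r).
by rewrite col_mx0 row_mx0.
Qed.

Definition mvn_add (x y : mvn_monoid) : mvn_monoid :=
  mxmvn_class (dsum (repr x) (repr y)).

Lemma mvn_addE p q :
  mvn_add (mxmvn_class p) (mxmvn_class q) = mxmvn_class (dsum p q).
Proof.
apply/mxmvn_classP/dsum_mvn; apply/mxmvn_classP; exact: reprK.
Qed.

Lemma mvn_monoid_ind (P : mvn_monoid -> Prop) :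
  (forall p, P (mxmvn_class p)) -> forall x, P x.
Proof. by move=> h x; rewrite -(reprK x); exact: h. Qed.

Lemma mvn_addA : associative mvn_add.
Proof.
elim/mvn_monoid_ind => p; elim/mvn_monoid_ind => q; elim/mvn_monoid_ind => r.
by rewrite !mvn_addE; apply/mxmvn_classP/dsumA.
Qed.

Lemma mvn_addC : commutative mvn_add.
Proof.
elim/mvn_monoid_ind => p; elim/mvn_monoid_ind => q.
by rewrite !mvn_addE; apply/mxmvn_classP/dsumC.
Qed.

Lemma mvn_add0 : left_id (mxmvn_class mxpr00) mvn_add.
Proof.
by elim/mvn_monoid_ind => p; rewrite mvn_addE; apply/mxmvn_classP/dsum0.
Qed.

HB.instance Definition _ :=
  GRing.isNmodule.Build mvn_monoid mvn_addA mvn_addC mvn_add0.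

Definition K0 := groth mvn_monoid.
HB.instance Definition _ := GRing.Zmodule.on K0.

Definition K0_class (p : mxprojection) : K0 := groth_pair (mxmvn_class p) 0.

Definition K0_pos : set K0 := range K0_class.

Definition K0_unit : K0 := K0_class mxpr11.

End K0.

Section M1.
Context {R : realType}.

Definition I01 := set_type `[(0 : R), 1].

(* The finitely many break points are the elements of s; f is linear, with
   integer coefficients, on any interval having no element of s in its
   interior. *)
Definition M1 : set (I01 -> R) := [set f |
  continuous f /\
  exists s : seq R, forall x y : R,
    0 <= x -> x <= y -> y <= 1 ->
    (forall t, t \in s -> ~~ (x < t < y)) ->
    exists a b : int, forall t : I01,
      x <= \val t <= y -> f t = a%:~R * \val t + b%:~R].

End M1.
Arguments I01 R : clear implicits.
Arguments M1 R : clear implicits.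

(* (K_0(A), [1]) is isomorphic to (M_1, 1) as a unital ordered group. *)
Definition K0_iso_M1 (R : realType) (A : cstarAlgType R) : Prop :=
  exists phi : K0 A -> (I01 R -> R),
    [/\ {morph phi : x y / x + y},
        injective phi,
        range phi = M1 R,
        forall x, K0_pos x <-> forall t, 0 <= phi x t &
        phi (K0_unit A) = cst 1].

Definition is_farey_AF (R : realType) (A : cstarAlgType R) : Prop :=
  is_AF A /\ K0_iso_M1 A.

(* Main.v *)
(* Sending a projection [p] to the image of [[p]] in [M_1] identifies the Elliott
   monoid with the set of the McNaughton functions [f : [0, 1] -> [0, 1]], with
   [f^* = 1 - f] and [f (+) g = min (f + g) 1]. Its injectivity is cancellation
   for projections of matrices over an AF algebra: equivalences are approximated
   in a finite-dimensional subalgebra, corrected to exact ones there by a Newton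
   iteration, and detected by the traces of that subalgebra. Surjectivity holds
   since [x + y = [1]] splits the unit into orthogonal projections of classes
   [x] and [y]. The sum of the Elliott monoid is forced by residuation.

   By McNaughton's theorem the identity function is a generator. Conversely a
   generator is an injective function, since otherwise two points could not be
   separated; it is then monotone with integer slopes, all of absolute value at
   least 1, so that it is [t] or [1 - t]. The substitution of [1 - t] for [t] is
   an automorphism exchanging the two. *)

Require Import Defs.
From HB Require Import structures.
From mathcomp Require Import all_boot all_order all_algebra generic_quotient.
From mathcomp Require Import complex ring lra zify.
From mathcomp Require Import all_classical all_reals all_analysis.

Set Implicit Arguments.
Unset Strict Implicit.
Unset Printing Implicit Defensive.

Import Order.TTheory GRing.Theory Num.Theory.
Import numFieldNormedType.Exports.

Local Open Scope classical_set_scope.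
Local Open Scope complex_scope.
Local Open Scope ring_scope.
Local Open Scope quotient_scope.

(** * Norm estimates and closed subspaces *)

Section NormBasics.
Context {R : realType} {A : cstarAlgType R}.
Implicit Types (a b x y : A) (c : R[i]).
Local Notation normc := (@Normc.normc R).

Lemma normc_real (r : R) : normc r%:C = `|r|.
Proof. by rewrite /Normc.normc /= expr0n /= addr0 sqrtr_sqr. Qed.

Lemma normc_ge0 c : 0 <= normc c.
Proof. by case: c => a b; exact: sqrtr_ge0. Qed.

Lemma cnorm0 : cnorm (0 : A) = 0.
Proof. by rewrite -(scale0r (1 : A)) cnormZ Normc.normc0 mul0r. Qed.

Lemma cnormN a : cnorm (- a) = cnorm a.
Proof.
rewrite -scaleN1r cnormZ.
have -> : (-1 : R[i]) = (-1)%:C by rewrite rmorphN1.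
by rewrite normc_real normrN1 mul1r.
Qed.

Lemma cnorm_ge0 a : 0 <= cnorm a.
Proof.
have := cnormD a (- a); rewrite subrr cnorm0 cnormN -mulr2n pmulrn_lge0//.
Qed.

Lemma cnormB a b : cnorm (a - b) = cnorm (b - a).
Proof. by rewrite -cnormN opprB. Qed.

Lemma cnorm_dist a b x : cnorm (a - b) <= cnorm (a - x) + cnorm (x - b).
Proof. by rewrite (_ : a - b = (a - x) + (x - b)) ?cnormD// addrA subrK. Qed.

Lemma cnorm_sum (I : Type) (s : seq I) (P : pred I) (F : I -> A) :
  cnorm (\sum_(i <- s | P i) F i) <= \sum_(i <- s | P i) cnorm (F i).
Proof.
elim/big_ind2 : _ => [|x1 x2 y1 y2 h1 h2|//]; first by rewrite cnorm0.
exact: le_trans (cnormD _ _) (lerD h1 h2).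
Qed.

Lemma cnorm_le_star a : cnorm a <= cnorm (cstar a).
Proof.
have [->|a0] := eqVneq (cnorm a) 0; first exact: cnorm_ge0.
have ap : 0 < cnorm a by rewrite lt_def a0 cnorm_ge0.
by rewrite -(ler_pM2r ap) -expr2 -cnorm_star cnormM.
Qed.

Lemma cnorm_cstar a : cnorm (cstar a) = cnorm a.
Proof. by apply/le_anti; rewrite cnorm_le_star -{2}(cstarK a) cnorm_le_star. Qed.

Lemma cstarB a b : cstar (a - b) = cstar a - cstar b.
Proof. by rewrite cstarD cstarN. Qed.

Lemma cstar_eq0 a : cstar a * a = 0 -> a = 0.
Proof.
move=> h; apply: cnorm_eq0; apply/eqP; rewrite -sqrf_eq0.
by rewrite -cnorm_star h cnorm0.
Qed.

End NormBasics.

Section Span.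
Context {R : realType} {A : cstarAlgType R}.
Local Notation normc := (@Normc.normc R).

Definition cclosed (V : set A) : Prop :=
  forall x, (forall e : R, 0 < e -> exists2 v, V v & cnorm (x - v) < e) -> V x.

Definition cspan n (e : 'I_n -> A) : set A :=
  [set \sum_(i < n) c i *: e i | c in [set: 'I_n -> R[i]]].

Lemma cspan0 n (e : 'I_n -> A) : cspan e 0.
Proof. by exists (fun=> 0) => //; rewrite big1// => i _; rewrite scale0r. Qed.

Lemma cspanD n (e : 'I_n -> A) x y : cspan e x -> cspan e y -> cspan e (x + y).
Proof.
move=> [c _ <-] [d _ <-]; exists (fun i => c i + d i) => //.
by rewrite -big_split; apply: eq_bigr => i _; rewrite scalerDl.
Qed.

Lemma cspanZ n (e : 'I_n -> A) (k : R[i]) x : cspan e x -> cspan e (k *: x).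
Proof.
move=> [c _ <-]; exists (fun i => k * c i) => //.
by rewrite scaler_sumr; apply: eq_bigr => i _; rewrite scalerA.
Qed.

Lemma Re_normc (z : R[i]) : `|complex.Re z| <= normc z.
Proof.
case: z => a b /=; rewrite -sqrtr_sqr ler_sqrt ?lerDl ?sqr_ge0//.
by rewrite addr_ge0 ?sqr_ge0.
Qed.

Lemma Im_normc (z : R[i]) : `|complex.Im z| <= normc z.
Proof.
case: z => a b /=; rewrite -sqrtr_sqr ler_sqrt ?lerDr ?sqr_ge0//.
by rewrite addr_ge0 ?sqr_ge0.
Qed.

Lemma normc_le (z : R[i]) : normc z <= `|complex.Re z| + `|complex.Im z|.
Proof.
case: z => a b /=; rewrite -(ler_pXn2r (n := 2)) ?nnegrE ?sqrtr_ge0 ?addr_ge0//.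
rewrite sqr_sqrtr ?addr_ge0 ?sqr_ge0// sqrrD !real_normK ?num_real//.
by rewrite -addrA [X in _ <= _ + X]addrC lerD2l lerDl mulrn_wge0 ?mulr_ge0.
Qed.

Lemma real_cauchy (u : nat -> R) :
  (forall e : R, 0 < e ->
    exists N, forall m n, (N <= m)%N -> (N <= n)%N -> `|u m - u n| < e) ->
  exists l, forall e : R, 0 < e ->
    exists N, forall n, (N <= n)%N -> `|u n - l| < e.
Proof.
move=> cu.
have /cauchy_cvg/cvg_ex[l /cvgrPdist_lt ul] : cauchy (u @ \oo).
  apply: cauchy_exP => e e0; have [N hN] := cu e e0.
  by exists (u N); exists N => // n /= Nn; exact: hN.
exists l => e e0; have [N _ hN] := ul e e0.
by exists N => n Nn; rewrite distrC; exact: hN.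
Qed.

Lemma complex_cauchy (u : nat -> R[i]) :
  (forall e : R, 0 < e ->
    exists N, forall m n, (N <= m)%N -> (N <= n)%N -> normc (u m - u n) < e) ->
  exists l, forall e : R, 0 < e ->
    exists N, forall n, (N <= n)%N -> normc (u n - l) < e.
Proof.
move=> cu.
have [|a ha] := @real_cauchy (fun n => complex.Re (u n)).
  move=> e /cu[N hN]; exists N => m n hm hn.
  by rewrite -raddfB; apply: le_lt_trans (Re_normc _) (hN _ _ hm hn).
have [|b hb] := @real_cauchy (fun n => complex.Im (u n)).
  move=> e /cu[N hN]; exists N => m n hm hn.
  by rewrite -raddfB; apply: le_lt_trans (Im_normc _) (hN _ _ hm hn).
exists (Complex a b) => e e0.
have e2 : 0 < e / 2 by rewrite divr_gt0.
have [M hM] := ha _ e2; have [N hN] := hb _ e2.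
exists (maxn M N) => n; rewrite geq_max => /andP[Mn Nn].
apply: le_lt_trans (normc_le _) _; rewrite !raddfB /= (splitr e).
by rewrite ltrD ?hM ?hN.
Qed.

Lemma inv_nat_lt (e : R) : 0 < e -> exists N, forall n, (N <= n)%N -> n.+1%:R^-1 < e.
Proof.
move=> e0; have [N hN] := ltr_add_invr (y := 0) (x := e) e0.
exists N => n Nn; rewrite add0r in hN; apply: le_lt_trans hN.
by rewrite lef_pV2 ?posrE// ler_nat.
Qed.

(* If [V] is closed and [y] is not in [V], then the distance from [y] to [V] is
   positive and bounds the coefficients of [y] in a convergent sequence. *)
Lemma cclosed_add_line (V : set A) (y : A) :
  V 0 -> (forall a b, V a -> V b -> V (a + b)) ->
  (forall (k : R[i]) a, V a -> V (k *: a)) -> cclosed V ->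
  cclosed [set v + c *: y | v in V & c in [set: R[i]]].
Proof.
move=> V0 VD VZ Vcl x hx.
have VN a : V a -> V (- a) by move=> /(VZ (-1)); rewrite scaleN1r.
have [Vy|nVy] := pselect (V y).
  exists x; last by exists 0 => //; rewrite scale0r addr0.
  by apply: Vcl => e /hx[_ [v Vv [c _ <-]] h]; exists (v + c *: y) => //; apply/VD/VZ.
have [d d0 hd] : exists2 d : R, 0 < d & forall v, V v -> d <= cnorm (y - v).
  apply: contrapT => h; apply: nVy; apply: Vcl => e e0.
  apply: contrapT => k; apply: h; exists e => // v Vv.
  by rewrite leNgt; apply/negP => hv; apply: k; exists v.
have hd2 v c : V v -> normc c * d <= cnorm (v + c *: y).
  move=> Vv; have [->|c0] := eqVneq c 0; first by rewrite Normc.normc0 mul0r cnorm_ge0.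
  have -> : v + c *: y = c *: (y - (- c^-1) *: v).
    by rewrite scalerBr scalerA mulrN divff// scaleN1r opprK addrC.
  by rewrite cnormZ ler_wpM2l ?normc_ge0// hd//; exact: VZ.
have {hx} [v [c [Vv vc]]] : exists v c, (forall n, V (v n)) /\
    forall n, cnorm (x - (v n + c n *: y)) < n.+1%:R^-1.
  have h n : exists vc : A * R[i], V vc.1 /\ cnorm (x - (vc.1 + vc.2 *: y)) < n.+1%:R^-1.
    have /hx[_ [v Vv [c _ <-]] hv] : 0 < n.+1%:R^-1 :> R by rewrite invr_gt0.
    by exists (v, c).
  have [f hf] := choice h.
  by exists (fst \o f), (snd \o f); split=> n /=; have [] := hf n.
have [|l hl] := @complex_cauchy c.
  move=> e e0; have ed : 0 < e * d / 2 by rewrite divr_gt0 ?mulr_gt0.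
  have [N hN] := inv_nat_lt ed; exists N => m n Nm Nn.
  rewrite -(ltr_pM2r d0); apply: le_lt_trans (hd2 (v m - v n) _ _) _.
    by apply: VD => //; exact: VN.
  have -> : v m - v n + (c m - c n) *: y = v m + c m *: y - (v n + c n *: y).
    by rewrite scalerBl opprD addrACA.
  apply: le_lt_trans (cnorm_dist _ _ x) _.
  rewrite (splitr (e * d)) cnormB ltrD//; apply: lt_trans (vc _) (hN _ _) => //.
exists (x - l *: y); last by exists l => //; rewrite subrK.
apply: Vcl => e e0.
have e2 : 0 < e / 2 by rewrite divr_gt0.
have yp : 0 < cnorm y + 1 by rewrite ltr_wpDl ?cnorm_ge0.
have [N1 hN1] := inv_nat_lt e2.
have [N2 hN2] := hl (e / 2 / (cnorm y + 1)) (divr_gt0 e2 yp).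
pose n := maxn N1 N2; exists (v n) => //.
have -> : x - l *: y - v n = x - (v n + c n *: y) + (c n - l) *: y.
  by rewrite scalerBl opprD (addrA x) addrA subrK addrAC.
apply: le_lt_trans (cnormD _ _) _; rewrite (splitr e) ltr_leD//.
  by apply: lt_le_trans (vc _) _; apply/ltW/hN1; rewrite leq_maxl.
rewrite cnormZ; have /ltW := hN2 n (leq_maxr _ _).
rewrite ler_pdivlMr// => h; apply: le_trans h.
by rewrite ler_wpM2l ?normc_ge0// lerDl.
Qed.

Lemma cspan_closed n (e : 'I_n -> A) : cclosed (cspan e).
Proof.
elim: n e => [|n IH] e.
  move=> x hx; exists (fun=> 0) => //; rewrite big_ord0.
  apply/esym/cnorm_eq0/le_anti; rewrite cnorm_ge0 andbT.
  apply/ler_addgt0Pl => d /hx[_ [c _ <-]]; rewrite big_ord0 subr0 addr0.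
  exact: ltW.
have -> : cspan e = [set v + c *: e ord_max | v in cspan (fun i => e (widen_ord
  (leqnSn n) i)) & c in [set: R[i]]].
  apply/seteqP; split=> [_ [c _ <-]|_ [_ [c _ <-]] [d _ <-]].
    rewrite big_ord_recr /=; eexists; first by exists (fun i => c (widen_ord (leqnSn n) i)).
    by exists (c ord_max).
  exists (fun i : 'I_n.+1 => if unlift ord_max i is Some j then c j else d) => //.
  rewrite big_ord_recr /= unlift_none; congr (_ + _); apply: eq_bigr => i _.
  have -> : widen_ord (leqnSn n) i = lift ord_max i.
    by apply: val_inj; rewrite /= /bump leqNgt ltn_ord.
  by rewrite liftK.
apply: cclosed_add_line; [exact: cspan0|exact: cspanD|exact: cspanZ|exact: IH].
Qed.

End Span.

(** * Matrices over a C*-algebra *)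

Section MatrixNorm.
Context {R : realType} {A : cstarAlgType R}.

(* Not the C*-norm of the matrix algebra, but equivalent to it, submultiplicative
   and invariant under the adjoint. *)
Definition mxnorm m n (M : 'M[A]_(m, n)) : R := \sum_i \sum_j cnorm (M i j).

Lemma mxnorm_ge0 m n (M : 'M[A]_(m, n)) : 0 <= mxnorm M.
Proof. by apply: sumr_ge0 => i _; apply: sumr_ge0 => j _; exact: cnorm_ge0. Qed.

Lemma mxnormD m n (M N : 'M[A]_(m, n)) : mxnorm (M + N) <= mxnorm M + mxnorm N.
Proof.
rewrite /mxnorm -big_split; apply: ler_sum => i _.
by rewrite -big_split; apply: ler_sum => j _; rewrite mxE cnormD.
Qed.

Lemma mxnormN m n (M : 'M[A]_(m, n)) : mxnorm (- M) = mxnorm M.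
Proof. by apply: eq_bigr => i _; apply: eq_bigr => j _; rewrite mxE cnormN. Qed.

Lemma mxnormB m n (M N : 'M[A]_(m, n)) : mxnorm (M - N) = mxnorm (N - M).
Proof. by rewrite -mxnormN opprB. Qed.

Lemma mxnorm_dist m n (K M N : 'M[A]_(m, n)) :
  mxnorm (M - N) <= mxnorm (M - K) + mxnorm (K - N).
Proof. by rewrite (_ : M - N = (M - K) + (K - N)) ?mxnormD// addrA subrK. Qed.

Lemma mxnorm_adj m n (M : 'M[A]_(m, n)) : mxnorm (adjmx M) = mxnorm M.
Proof.
rewrite /mxnorm exchange_big; apply: eq_bigr => i _; apply: eq_bigr => j _.
by rewrite mxE cnorm_cstar.
Qed.

Lemma mxnorm_entry m n (M : 'M[A]_(m, n)) i j : cnorm (M i j) <= mxnorm M.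
Proof.
rewrite /mxnorm (bigD1 i)//= (bigD1 j)//= -addrA lerDl addr_ge0//.
  by apply: sumr_ge0 => l _; exact: cnorm_ge0.
by apply: sumr_ge0 => l _; apply: sumr_ge0 => k _; exact: cnorm_ge0.
Qed.

Lemma mxnorm_eq0 m n (M : 'M[A]_(m, n)) : mxnorm M = 0 -> M = 0.
Proof.
move=> M0; apply/matrixP => i j; rewrite mxE; apply/cnorm_eq0/le_anti.
by rewrite cnorm_ge0 andbT -M0 mxnorm_entry.
Qed.

Lemma mxnorm_le m n (M : 'M[A]_(m, n)) (e : R) :
  (forall i j, cnorm (M i j) <= e) -> mxnorm M <= (m * n)%:R * e.
Proof.
move=> h; apply: (@le_trans _ _ (\sum_(i < m) \sum_(j < n) e)).
  by apply: ler_sum => i _; apply: ler_sum => j _; exact: h.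
by rewrite !sumr_const !card_ord -mulrnA mulr_natl mulnC.
Qed.

Lemma mxnormM m n k (M : 'M[A]_(m, n)) (N : 'M[A]_(n, k)) :
  mxnorm (M *m N) <= mxnorm M * mxnorm N.
Proof.
rewrite /mxnorm mulr_suml; apply: ler_sum => i _.
apply: (@le_trans _ _ (\sum_j \sum_l cnorm (M i l) * cnorm (N l j))).
  apply: ler_sum => j _; rewrite mxE; apply: le_trans (cnorm_sum _ _ _) _.
  by apply: ler_sum => l _; exact: cnormM.
rewrite exchange_big mulr_suml; apply: ler_sum => l _.
rewrite -mulr_sumr ler_wpM2l ?cnorm_ge0// (bigD1 l)//= lerDl.
by apply: sumr_ge0 => p _; apply: sumr_ge0 => j _; exact: cnorm_ge0.
Qed.

Definition cmx m n (c : R) (M : 'M[A]_(m, n)) : 'M[A]_(m, n) :=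
  map_mx (fun a => c%:C *: a) M.

Lemma cmx_mull m n k c (M : 'M[A]_(m, n)) (N : 'M[A]_(n, k)) :
  cmx c M *m N = cmx c (M *m N).
Proof.
apply/matrixP => i j; rewrite !mxE scaler_sumr; apply: eq_bigr => l _.
by rewrite mxE scalerAl.
Qed.

Lemma cmx_mulr m n k c (M : 'M[A]_(m, n)) (N : 'M[A]_(n, k)) :
  M *m cmx c N = cmx c (M *m N).
Proof.
apply/matrixP => i j; rewrite !mxE scaler_sumr; apply: eq_bigr => l _.
by rewrite mxE scalerAr.
Qed.

Lemma conj_real (r : R) : Num.conj (r%:C : R[i]) = r%:C.
Proof. by apply/CrealP; rewrite complex_real. Qed.

Lemma adj_cmx m n c (M : 'M[A]_(m, n)) : adjmx (cmx c M) = cmx c (adjmx M).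
Proof. by apply/matrixP => i j; rewrite !mxE cstarZ conj_real. Qed.

Lemma cmxD m n c (M N : 'M[A]_(m, n)) : cmx c (M + N) = cmx c M + cmx c N.
Proof. by apply/matrixP => i j; rewrite !mxE scalerDr. Qed.

Lemma cmxN m n c (M : 'M[A]_(m, n)) : cmx c (- M) = - cmx c M.
Proof. by apply/matrixP => i j; rewrite !mxE scalerN. Qed.

Lemma cmx_cmx m n c d (M : 'M[A]_(m, n)) : cmx c (cmx d M) = cmx (c * d) M.
Proof. by apply/matrixP => i j; rewrite !mxE scalerA -rmorphM. Qed.

Lemma cmxDl m n c d (M : 'M[A]_(m, n)) : cmx (c + d) M = cmx c M + cmx d M.
Proof. by apply/matrixP => i j; rewrite !mxE -scalerDl -rmorphD. Qed.

Lemma cmx1 m n (M : 'M[A]_(m, n)) : cmx 1 M = M.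
Proof. by apply/matrixP => i j; rewrite !mxE scale1r. Qed.

Lemma mxnorm_cmx m n c (M : 'M[A]_(m, n)) : mxnorm (cmx c M) = `|c| * mxnorm M.
Proof.
rewrite /mxnorm mulr_sumr; apply: eq_bigr => i _.
by rewrite mulr_sumr; apply: eq_bigr => j _; rewrite mxE cnormZ normc_real.
Qed.

Lemma adjmxD m n (M N : 'M[A]_(m, n)) : adjmx (M + N) = adjmx M + adjmx N.
Proof. by apply/matrixP => i j; rewrite !mxE cstarD. Qed.

Lemma adjmxB m n (M N : 'M[A]_(m, n)) : adjmx (M - N) = adjmx M - adjmx N.
Proof. by apply/matrixP => i j; rewrite !mxE cstarB. Qed.

Lemma adjmx1 n : adjmx (1%:M : 'M[A]_n) = 1%:M.
Proof.
apply/matrixP => i j; rewrite !mxE eq_sym; case: (_ == _); last exact: cstar0.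
exact: cstar1.
Qed.

End MatrixNorm.

Section StarSubalgebra.
Context {R : realType} {A : cstarAlgType R}.

Definition star_subalg (F : set A) : Prop :=
  [/\ F 1, forall a b, F a -> F b -> F (a + b),
      forall (c : R[i]) a, F a -> F (c *: a),
      forall a b, F a -> F b -> F (a * b) & forall a, F a -> F (cstar a)].

Context {F : set A} (Fsub : star_subalg F).

Lemma subalg1 : F 1. Proof. by case: Fsub. Qed.
Lemma subalgD a b : F a -> F b -> F (a + b).
Proof. by case: Fsub => _ h _ _ _; exact: h. Qed.
Lemma subalgZ (c : R[i]) a : F a -> F (c *: a).
Proof. by case: Fsub => _ _ h _ _; exact: h. Qed.
Lemma subalgM a b : F a -> F b -> F (a * b).
Proof. by case: Fsub => _ _ _ h _; exact: h. Qed.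
Lemma subalgS a : F a -> F (cstar a).
Proof. by case: Fsub => _ _ _ _ h; exact: h. Qed.
Lemma subalg0 : F 0. Proof. by rewrite -(scale0r 1); apply/subalgZ/subalg1. Qed.
Lemma subalgN a : F a -> F (- a).
Proof. by rewrite -scaleN1r; exact: subalgZ. Qed.
Lemma subalgB a b : F a -> F b -> F (a - b).
Proof. by move=> Fa Fb; apply/subalgD/subalgN. Qed.
Lemma subalg_sum (I : Type) (s : seq I) (P : pred I) (G : I -> A) :
  (forall i, P i -> F (G i)) -> F (\sum_(i <- s | P i) G i).
Proof. by move=> h; apply: big_ind => //; [exact: subalg0|exact: subalgD]. Qed.

Definition mx_in (G : set A) m n (M : 'M[A]_(m, n)) := forall i j, G (M i j).

Lemma mx_inM m n k (M : 'M[A]_(m, n)) (N : 'M[A]_(n, k)) :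
  mx_in F M -> mx_in F N -> mx_in F (M *m N).
Proof.
by move=> hM hN i j; rewrite mxE; apply: subalg_sum => l _; exact: subalgM.
Qed.
Lemma mx_inD m n (M N : 'M[A]_(m, n)) : mx_in F M -> mx_in F N -> mx_in F (M + N).
Proof. by move=> hM hN i j; rewrite mxE; exact: subalgD. Qed.
Lemma mx_inB m n (M N : 'M[A]_(m, n)) : mx_in F M -> mx_in F N -> mx_in F (M - N).
Proof. by move=> hM hN i j; rewrite !mxE; exact: subalgB. Qed.
Lemma mx_in_cmx m n c (M : 'M[A]_(m, n)) : mx_in F M -> mx_in F (cmx c M).
Proof. by move=> hM i j; rewrite mxE; exact: subalgZ. Qed.
Lemma mx_in_adj m n (M : 'M[A]_(m, n)) : mx_in F M -> mx_in F (adjmx M).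
Proof. by move=> hM i j; rewrite mxE; exact: subalgS. Qed.
Lemma mx_in1 n : mx_in F (1%:M : 'M[A]_n).
Proof. by move=> i j; rewrite mxE; case: (_ == _); [exact: subalg1|exact: subalg0]. Qed.
End StarSubalgebra.

Section Convergence.
Context {R : realType} {A : cstarAlgType R}.

Lemma expr_half_lt (C e : R) : 0 < e -> exists j, C * 2^-1 ^+ j < e.
Proof.
move=> e0.
have [C0|C0] := leP C 0.
  by exists 0%N; apply: le_lt_trans e0; rewrite mulr1.
have [j hj] := inv_nat_lt (divr_gt0 e0 C0).
exists j; rewrite mulrC -ltr_pdivlMr//; apply: le_lt_trans (hj j (leqnn j)).
rewrite exprVn lef_pV2 ?posrE ?exprn_gt0//.
by rewrite -natrX ler_nat ltn_expl.
Qed.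

Lemma le0_expr_half (x C : R) : (forall j, x <= C * 2^-1 ^+ j) -> x <= 0.
Proof.
move=> h; rewrite leNgt; apply/negP => x0.
by have [j] := expr_half_lt C x0; rewrite ltNge h.
Qed.

Lemma geometric_dist (u : nat -> A) (C : R) :
  (forall j, cnorm (u j.+1 - u j) <= C * 2^-1 ^+ j) ->
  forall j k, cnorm (u (j + k)%N - u j) <= 2 * C * 2^-1 ^+ j - 2 * C * 2^-1 ^+ (j + k).
Proof.
move=> hu j; elim=> [|k IH]; first by rewrite addn0 !subrr cnorm0.
rewrite addnS; apply: le_trans (cnorm_dist _ _ (u (j + k)%N)) _.
apply: le_trans (lerD (hu _) IH) _; rewrite exprS.
by move: (_ ^+ (j + k)) (_ ^+ j) => x y; lra.
Qed.

Lemma geometric_cvg (F : set A) (u : nat -> A) (C : R) : cclosed F ->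
  (forall j, F (u j)) ->
  (forall j, cnorm (u j.+1 - u j) <= C * 2^-1 ^+ j) ->
  exists2 l, F l & forall j, cnorm (u j - l) <= 2 * C * 2^-1 ^+ j.
Proof.
move=> Fcl Fu hu.
have C0 : 0 <= C by have := le_trans (cnorm_ge0 _) (hu 0%N); rewrite mulr1.
have hu1 j k : (j <= k)%N -> cnorm (u k - u j) <= 2 * C * 2^-1 ^+ j.
  move=> /subnKC <-; apply: le_trans (geometric_dist hu _ _) _.
  by rewrite gerBl !mulr_ge0// exprn_ge0// invr_ge0.
have [|l hl] := @cnorm_complete R A u.
  move=> e e0; have [j hj] := expr_half_lt (2 * C + 2 * C) e0.
  exists j => m n jm jn; apply: le_lt_trans (cnorm_dist _ _ (u j)) _.
  by apply: le_lt_trans hj; rewrite mulrDl lerD ?hu1// cnormB hu1.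
have hl2 j : cnorm (u j - l) <= 2 * C * 2^-1 ^+ j.
  apply/ler_addgt0Pr => e /hl[N hN].
  apply: le_trans (cnorm_dist _ _ (u (maxn j N))) _.
  by rewrite cnormB lerD ?hu1 ?leq_maxl// ltW// hN// leq_maxr.
exists l => //; apply: Fcl => e e0; have [j hj] := expr_half_lt (2 * C) e0.
by exists (u j) => //; rewrite cnormB; apply: le_lt_trans hj.
Qed.

Lemma geometric_mx_cvg (F : set A) m n (u : nat -> 'M[A]_(m, n)) (C : R) :
  cclosed F -> (forall j, mx_in F (u j)) ->
  (forall j, mxnorm (u j.+1 - u j) <= C * 2^-1 ^+ j) ->
  exists2 l, mx_in F l &
    forall j, mxnorm (u j - l) <= (m * n)%:R * (2 * C) * 2^-1 ^+ j.
Proof.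
move=> Fcl Fu hu.
have h i k : exists l, F l /\ forall j, cnorm (u j i k - l) <= 2 * C * 2^-1 ^+ j.
  have [||l Fl hl] := @geometric_cvg F (fun j => u j i k) C Fcl.
  - by move=> j; exact: Fu.
  - move=> j; apply: le_trans (hu j).
    by have := mxnorm_entry (u j.+1 - u j) i k; rewrite !mxE.
  - by exists l.
have [l hl] := choice (fun ik : 'I_m * 'I_n => h ik.1 ik.2).
exists (\matrix_(i, k) l (i, k)) => [i k|j].
  by rewrite mxE; have [] := hl (i, k).
rewrite -mulrA; apply: mxnorm_le => i k; rewrite !mxE.
by have [_] := hl (i, k); apply.
Qed.

End Convergence.

(** * Polar decomposition of near partial isometries *)

Section Polar.
Context {R : realType} {A : cstarAlgType R}.

(* Newton's iteration [w (3 - w^* w) / 2] for the polar decomposition. *)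
Definition polar_step m n (P : 'M[A]_n) (w : 'M[A]_(m, n)) :=
  w + cmx 2^-1 (w *m (P - adjmx w *m w)).

Lemma polar_step_corner m n (P : 'M[A]_n) (w : 'M[A]_(m, n)) :
  P *m P = P -> w *m P = w -> polar_step P w *m P = polar_step P w.
Proof.
move=> PP wP; rewrite /polar_step mulmxDl cmx_mull wP -mulmxA mulmxBl PP.
by rewrite -(mulmxA (adjmx w)) wP.
Qed.

Lemma polar_step_defect m n (P : 'M[A]_n) (w : 'M[A]_(m, n))
    (g := cmx 2^-1 (P - adjmx w *m w)) :
  adjmx P = P -> P *m P = P -> w *m P = w ->
  P - adjmx (polar_step P w) *m polar_step P w
  = (g *m g) *+ 3 + (g *m g *m g) *+ 2.
Proof.
move=> Padj PP wP.
have wPa : P *m adjmx w = adjmx w by rewrite -[in LHS]Padj -adjmxM wP.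
have gadj : adjmx g = g by rewrite adj_cmx adjmxB Padj adjmxM adjmxK.
have Pg : P *m g = g by rewrite cmx_mulr mulmxBr PP mulmxA wPa.
have gP : g *m P = g by rewrite cmx_mull mulmxBl PP -mulmxA wP.
have gg : g + g = P - adjmx w *m w.
  rewrite -cmxDl (_ : 2^-1 + 2^-1 = 1 :> R) ?cmx1//; lra.
have ww : adjmx w *m w = P - (g + g) by rewrite gg opprB addrC subrK.
have -> : polar_step P w = w *m (P + g) by rewrite mulmxDr wP /polar_step cmx_mulr.
rewrite adjmxM adjmxD Padj gadj -mulmxA (mulmxA (adjmx w)) ww mulmxA.
have -> : (P + g) *m (P - (g + g)) = P - g - (g *m g) *+ 2.
  rewrite mulmxDl !mulmxBr !mulmxDr PP Pg gP mulr2n opprD addrA.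
  by rewrite -(addrA P) subrK.
rewrite mulmxDr !mulmxBl PP Pg gP mulr2n !mulmxDl -[g *m g *m P]mulmxA gP.
set y := g *m g; set z := y *m g.
rewrite !opprD !opprK !addrA subrr add0r -(addrA g) [g + (y + y)]addrC addrK.
by rewrite mulrSr !mulr2n ?addrA.
Qed.

Definition polar_iter m n (P : 'M[A]_n) (w : 'M[A]_(m, n)) j :=
  iter j (polar_step P) w.

Section Iterates.
Context {m n : nat} {P : 'M[A]_n} {w : 'M[A]_(m, n)}.
Hypotheses (Padj : adjmx P = P) (PP : P *m P = P) (wP : w *m P = w).
Let d := mxnorm (P - adjmx w *m w).
Hypothesis d_half : d <= 2^-1.
Local Notation W := (polar_iter P w).
Local Notation H j := (P - adjmx (W j) *m W j).

Lemma polar_iter_corner j : W j *m P = W j.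
Proof. by elim: j => //= j IH; exact: polar_step_corner. Qed.

Lemma polar_iter_defect j : mxnorm (H j) <= d * 2^-1 ^+ j.
Proof.
elim: j => [|j IH]; first by rewrite mulr1.
have d0 : 0 <= d by exact: mxnorm_ge0.
have h0 := mxnorm_ge0 (H j).
have h2 : mxnorm (H j) <= 2^-1.
  apply: le_trans IH _; rewrite -[leRHS]mulr1; apply: ler_pM => //.
  by rewrite exprn_ile1// ?invr_ge0// invf_le1 ?ler1n.
rewrite polar_step_defect//; last exact: polar_iter_corner.
set g := cmx _ _; have hg : mxnorm g = 2^-1 * mxnorm (H j).
  by rewrite mxnorm_cmx ger0_norm.
have g0 := mxnorm_ge0 g.
have h3 := mxnormM g g; have h4 := mxnormM (g *m g) g.
have h5 : mxnorm (g *m g *m g) <= mxnorm g ^+ 3.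
  apply: le_trans h4 _; rewrite exprSr ler_wpM2r//; exact: h3.
have h6 : mxnorm (g *m g *+ 3 + g *m g *m g *+ 2) <= 3 * mxnorm g ^+ 2 + 2 * mxnorm g ^+ 3.
  rewrite mulrSr !mulr2n.
  have -> : 3 * mxnorm g ^+ 2 + 2 * mxnorm g ^+ 3
    = mxnorm g ^+ 2 + mxnorm g ^+ 2 + mxnorm g ^+ 2 + (mxnorm g ^+ 3 + mxnorm g ^+ 3) by ring.
  by do ?[apply: le_trans (mxnormD _ _) _; apply: lerD => //].
apply: le_trans h6 _; rewrite [in leRHS]exprSr [leRHS]mulrA.
apply: (@le_trans _ _ (mxnorm (H j) * 2^-1)); last by apply: ler_wpM2r.
rewrite hg in g0 *; move: (mxnorm (H j)) h0 h2 => x x0 x2.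
rewrite -subr_ge0.
have -> : x * 2^-1 - (3 * (2^-1 * x) ^+ 2 + 2 * (2^-1 * x) ^+ 3)
  = x * (4^-1 * (2^-1 - x) * (x + 7/2) + 16^-1) by field.
by rewrite mulr_ge0// addr_ge0// !mulr_ge0 ?subr_ge0//; lra.
Qed.

Lemma polar_iter_bound j : mxnorm (W j) <= mxnorm w * (2 - 2^-1 ^+ j).
Proof.
elim: j => [|j IH]; first by rewrite expr0 (_ : 2 - 1 = 1 :> R) ?mulr1//; lra.
have t0 : 0 <= 2^-1 ^+ j :> R by rewrite exprn_ge0.
have t1 : 2^-1 ^+ j <= 1 :> R by rewrite exprn_ile1// invf_le1 ?ler1n.
rewrite [W j.+1]/(W j + cmx 2^-1 (W j *m H j)).
apply: le_trans (mxnormD _ _) _; rewrite mxnorm_cmx ger0_norm//.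
have h1 := mxnormM (W j) (H j); have h2 := polar_iter_defect j.
have w0 := mxnorm_ge0 w; have W0 := mxnorm_ge0 (W j); have H0 := mxnorm_ge0 (H j).
have h3 : mxnorm (H j) <= 2^-1 * 2^-1 ^+ j.
  by apply: le_trans h2 _; rewrite ler_wpM2r.
rewrite exprS; move: (2^-1 ^+ j) t0 t1 IH h3 {h2} => t t0 t1 IH h3.
apply: (@le_trans _ _ (mxnorm (W j) * (1 + t / 4))).
  rewrite mulrDr mulr1 lerD2l; apply: le_trans (ler_wpM2l _ h1) _ => //.
  rewrite mulrCA ler_wpM2l//; lra.
apply: (@le_trans _ _ (mxnorm w * (2 - t) * (1 + t / 4))).
  by rewrite ler_wpM2r//; lra.
rewrite -mulrA ler_wpM2l//; nra.
Qed.

Lemma polar_iter_incr j : mxnorm (W j.+1 - W j) <= mxnorm w * d * 2^-1 ^+ j.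
Proof.
have -> : W j.+1 - W j = cmx 2^-1 (W j *m H j) by rewrite /= addrC addKr.
rewrite mxnorm_cmx ger0_norm//.
have h1 := mxnormM (W j) (H j); have h2 := polar_iter_defect j.
have h3 : mxnorm (W j) <= mxnorm w * 2.
  apply: le_trans (polar_iter_bound j) _; rewrite ler_wpM2l ?mxnorm_ge0//.
  by rewrite gerBl exprn_ge0.
have := ler_pM (mxnorm_ge0 _) (mxnorm_ge0 _) h3 h2 => h4.
have := le_trans h1 h4; lra.
Qed.

Lemma polar_iter_in F j : star_subalg F -> mx_in F P -> mx_in F w -> mx_in F (W j).
Proof.
move=> Fsub FP Fw; elim: j => //= j IH.
apply/mx_inD/mx_in_cmx => //; apply/mx_inM/mx_inB => //.
by apply/mx_inM => //; exact: mx_in_adj.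
Qed.

Lemma mxnorm_le_eq (M N : 'M[A]_n) : mxnorm (M - N) <= 0 -> M = N.
Proof.
move=> h; apply/eqP; rewrite -subr_eq0; apply/eqP/mxnorm_eq0/le_anti.
by rewrite h mxnorm_ge0.
Qed.

Lemma polar_limit v (C : R) :
  (forall j, mxnorm (W j - v) <= C * 2^-1 ^+ j) -> adjmx v *m v = P.
Proof.
move=> hv; apply/esym/mxnorm_le_eq.
apply: (@le0_expr_half _ _ (d + (mxnorm w * 2 + mxnorm v) * C)) => j.
apply: le_trans (mxnorm_dist (adjmx (W j) *m W j) _ _) _.
rewrite mulrDl lerD ?polar_iter_defect//.
have -> : adjmx (W j) *m W j - adjmx v *m v = adjmx (W j) *m (W j - v) + adjmx (W j - v) *m v.
  by rewrite adjmxB mulmxBr mulmxBl addrA subrK.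
apply: le_trans (mxnormD _ _) _.
rewrite -mulrA mulrDl; apply: lerD.
  apply: le_trans (mxnormM _ _) _; rewrite mxnorm_adj.
  rewrite ler_pM ?mxnorm_ge0//.
  apply: le_trans (polar_iter_bound j) _; rewrite ler_wpM2l ?mxnorm_ge0//.
  by rewrite gerBl exprn_ge0.
apply: le_trans (mxnormM _ _) _; rewrite mxnorm_adj mulrC.
by rewrite ler_wpM2l ?mxnorm_ge0.
Qed.

End Iterates.

Lemma polar_iter_left m n (P : 'M[A]_n) (Q : 'M[A]_m) (w : 'M[A]_(m, n)) j :
  Q *m Q = Q -> Q *m w = w -> Q *m polar_iter P w j = polar_iter P w j.
Proof.
move=> QQ Qw; elim: j => //= j IH.
by rewrite /polar_step mulmxDr cmx_mulr mulmxA IH.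
Qed.

Lemma polar_iter_adj m n (P : 'M[A]_n) (Q : 'M[A]_m) (w : 'M[A]_(m, n)) j :
  adjmx P = P -> adjmx Q = Q -> P *m P = P -> Q *m Q = Q ->
  w *m P = w -> Q *m w = w ->
  adjmx (polar_iter P w j) = polar_iter Q (adjmx w) j.
Proof.
move=> Pa Qa PP QQ wP Qw; elim: j => //= j <-.
have := polar_iter_corner PP wP j; have := polar_iter_left P j QQ Qw.
move: (polar_iter P w j) => v Qv vP.
have Pv : P *m adjmx v = adjmx v by rewrite -[in LHS]Pa -adjmxM vP.
have vQ : adjmx v *m Q = adjmx v by rewrite -[in LHS]Qa -adjmxM Qv.
rewrite /polar_step adjmxD adj_cmx adjmxM adjmxB Pa adjmxM !adjmxK.
by rewrite mulmxBl mulmxBr Pv vQ mulmxA.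
Qed.

Lemma near_partial_isometry (F : set A) m n (P : 'M[A]_n) (Q : 'M[A]_m)
    (w : 'M[A]_(m, n)) :
  star_subalg F -> cclosed F -> mx_in F P -> mx_in F w ->
  adjmx P = P -> adjmx Q = Q -> P *m P = P -> Q *m Q = Q ->
  w *m P = w -> Q *m w = w ->
  mxnorm (P - adjmx w *m w) <= 2^-1 -> mxnorm (Q - w *m adjmx w) <= 2^-1 ->
  exists v : 'M[A]_(m, n), [/\ mx_in F v, adjmx v *m v = P & v *m adjmx v = Q].
Proof.
move=> Fsub Fcl FP Fw Pa Qa PP QQ wP Qw hP hQ.
have [|v Fv hv] := geometric_mx_cvg (u := polar_iter P w) Fcl _
  (polar_iter_incr Pa PP wP hP).
  by move=> j; exact: polar_iter_in.
exists v; split=> //; first exact: polar_limit hv.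
rewrite -[X in X *m _]adjmxK; apply: (polar_limit (w := adjmx w) (P := Q)) => //.
- by rewrite -Qa -adjmxM Qw.
- by rewrite adjmxK.
- by move=> j; rewrite -(polar_iter_adj j Pa)// -adjmxB mxnorm_adj; exact: hv.
Qed.

Lemma near_symmetry (F : set A) n (w : 'M[A]_n) :
  star_subalg F -> cclosed F -> mx_in F w -> adjmx w = w ->
  mxnorm (1%:M - w *m w) <= 2^-1 ->
  exists s : 'M[A]_n, [/\ mx_in F s, adjmx s = s, s *m s = 1%:M &
    mxnorm (w - s) <= (n * n)%:R * (2 * (mxnorm w * mxnorm (1%:M - w *m w)))].
Proof.
move=> Fsub Fcl Fw wa hw.
have w1 : w *m 1%:M = w by exact: mulmx1.
have hw' : mxnorm (1%:M - adjmx w *m w) <= 2^-1 by rewrite wa.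
have [|s Fs hs] := geometric_mx_cvg (u := polar_iter 1%:M w) Fcl _
  (polar_iter_incr (adjmx1 n) (mulmx1 _) w1 hw').
  by move=> j; apply: polar_iter_in => //; exact: mx_in1.
have sa : adjmx s = s.
  apply: mxnorm_le_eq; apply: le0_expr_half => j.
  apply: le_trans (mxnorm_dist (polar_iter 1%:M w j) _ _) _.
  have wj : adjmx (polar_iter 1%:M w j) = polar_iter 1%:M w j.
    rewrite (polar_iter_adj (Q := 1%:M)) ?wa ?adjmx1 ?mulmx1 ?mul1mx//.
  rewrite -{1}wj -adjmxB mxnorm_adj mxnormB.
  apply: le_trans (lerD (hs j) (hs j)) _; rewrite -mulrDl; exact: lexx.
exists s; split=> //.
  rewrite -{1}sa; apply: (polar_limit (w := w) (P := 1%:M)) hs => //.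
  - exact: adjmx1.
  - exact: mulmx1.
by have := hs 0%N; rewrite mulr1 wa.
Qed.

End Polar.

(** * Minimal projections of finite-dimensional subalgebras *)

Section FiniteDimensional.
Context {R : realType} {A : cstarAlgType R}.

Definition is_proj (p : A) := cstar p = p /\ p * p = p.

Context {F : set A} (Fsub : star_subalg F) {n0 : nat} (e0 : 'I_n0 -> A).
Hypothesis Fspan : F `<=` cspan e0.

Lemma fd_dependent N (x : 'I_N -> A) : (n0 < N)%N -> (forall i, F (x i)) ->
  exists c : 'I_N -> R[i], (exists i, c i != 0) /\ \sum_i c i *: x i = 0.
Proof.
move=> nN Fx.
have Mex i : exists c : 'I_n0 -> R[i], \sum_j c j *: e0 j = x i.
  by have [c _ hc] := Fspan (Fx i); exists c.
have [M hM] := choice Mex.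
have : kermx (\matrix_(i, j) M i j) != 0.
  rewrite -mxrank_eq0 mxrank_ker -lt0n subn_gt0.
  by apply: leq_ltn_trans nN; exact: rank_leq_col.
move=> /rowV0Pn[c /sub_kermxP cM c0].
exists (fun i => c 0 i); split.
  apply: contrapT => h; move/eqP: c0; apply; apply/rowP => i; rewrite mxE.
  by apply/eqP; apply: contraPT isT => ci; exfalso; apply: h; exists i.
under eq_bigr => i _ do rewrite -hM scaler_sumr.
rewrite exchange_big big1// => j _.
under eq_bigr => i _ do rewrite scalerA.
rewrite -scaler_suml; have := congr1 (fun m : 'rV_n0 => m 0 j) cM; rewrite !mxE => h.
rewrite (_ : \sum_i _ = 0) ?scale0r// -[RHS]h.
by apply: eq_bigr => i _; rewrite !mxE.
Qed.

Definition orth_family k (p : 'I_k -> A) : Prop :=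
  [/\ forall i, F (p i), forall i, is_proj (p i), forall i, p i != 0,
      forall i j, i != j -> p i * p j = 0 & \sum_i p i = 1].

Lemma orth_family_bound k (p : 'I_k -> A) : orth_family p -> (k <= n0)%N.
Proof.
move=> [pF pP p0 pO _]; rewrite leqNgt; apply/negP => kn.
have [c [[i ci] hc]] := fd_dependent kn pF.
have := congr1 (fun x => p i * x) hc; rewrite mulr_sumr mulr0 (bigD1 i)//= big1.
  rewrite addr0 -scalerAr (pP i).2 => /eqP; rewrite scaler_eq0 (negPf ci).
  by rewrite (negPf (p0 i)).
by move=> j ji; rewrite -scalerAr pO ?scaler0// eq_sym.
Qed.

Definition unsplit (p : A) := forall q, F q -> is_proj q -> p * q = q ->
  q = 0 \/ q = p.

(* A partition of unity with the largest possible number of projections. *)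
Lemma unsplit_family : exists k (p : 'I_k -> A),
  orth_family p /\ forall i, unsplit (p i).
Proof.
pose S k := `[< exists p : 'I_k -> A, orth_family p >].
have S1 : exists k, S k.
  exists 1%N; apply/asboolP; exists (fun=> 1); split=> //.
  - by move=> _; exact: subalg1.
  - by move=> _; split; [exact: cstar1|exact: mulr1].
  - by move=> _; exact: oner_neq0.
  - by move=> i j; rewrite !ord1.
  - by rewrite big_ord1.
have Sb k : S k -> (k <= n0)%N by move=> /asboolP[p]; exact: orth_family_bound.
have [k /asboolP[p pf] kmax] := ex_maxnP S1 Sb.
exists k, p; split=> // i q Fq [qa qq] pq.
have [pF pP p0 pO p1] := pf.
have [->|q0] := eqVneq q 0; [by left|right].
apply/eqP; apply: contraPT isT => qp; exfalso.
have qp' : q * p i = q by rewrite -[in LHS]qa -(pP i).1 -cstarM pq.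
have d0 : p i - q != 0 by rewrite subr_eq0 eq_sym.
pose p' (j : 'I_k.+1) := if unlift ord_max j is Some l then
  (if l == i then q else p l) else p i - q.
have : S k.+1.
  apply/asboolP; exists p'; split.
  - move=> j; rewrite /p'; case: unliftP => [l _|_]; last exact: subalgB.
    by case: ifP.
  - move=> j; rewrite /p'; case: unliftP => [l _|_]; first by case: ifP.
    split; first by rewrite cstarB qa (pP i).1.
    by rewrite mulrBl !mulrBr (pP i).2 pq qp' qq subrr subr0.
  - by move=> j; rewrite /p'; case: unliftP => [l _|_] //; case: ifP.
  - have pql l : l != i -> p l * q = 0 by move=> li; rewrite -pq mulrA pO ?mul0r.
    have qpl l : l != i -> q * p l = 0.
      by move=> li; rewrite -qp' -mulrA pO ?mulr0// eq_sym.
    move=> j j'; rewrite /p'; case: unliftP => [l ->|->]; case: unliftP => [l' ->|->].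
    + rewrite (inj_eq lift_inj) => ll'; case: eqP => [li|/eqP li]; case: eqP => [l'i|/eqP l'i].
      * by move: ll'; rewrite li l'i eqxx.
      * exact: qpl.
      * exact: pql.
      * exact: pO.
    + move=> _; case: eqP => [li|/eqP li]; first by rewrite mulrBr qp' qq subrr.
      by rewrite mulrBr pql// pO// subrr.
    + move=> _; case: eqP => [li|/eqP li]; first by rewrite mulrBl pq qq subrr.
      by rewrite mulrBl qpl// pO ?subrr// eq_sym.
    + by rewrite eqxx.
  - rewrite big_ord_recr /= /p' unlift_none.
    rewrite (eq_bigr (fun l => if l == i then q else p l)); last first.
      move=> l _; have -> : widen_ord (leqnSn k) l = lift ord_max l.
        by apply: val_inj; rewrite /= /bump leqNgt ltn_ord.
      by rewrite liftK.
    rewrite (bigD1 i)//= eqxx -[RHS]p1 [in RHS](bigD1 i)//=.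
    rewrite (eq_bigr p) => [|l li]; last by rewrite (negPf li).
    by rewrite addrAC [q + _]addrC subrK.
by move=> /kmax; rewrite ltnn.
Qed.

Section Corner.
Context {p a : A}.
Hypotheses (Fp : F p) (pP : is_proj p) (p0 : p != 0) (p_unsplit : unsplit p).
Hypotheses (Fa : F a) (aS : cstar a = a) (pa : p * a = a) (ap : a * p = a).

Local Notation ev q := (horner_alg a q).

Lemma ev_in q : F (ev q).
Proof.
elim/poly_ind: q => [|q c IH]; first by rewrite rmorph0; exact: subalg0.
rewrite rmorphD rmorphM /= horner_algX horner_algC.
by apply: subalgD => //; [exact: subalgM|apply/subalgZ/subalg1].
Qed.

Lemma ev_comm b q : b * a = a * b -> b * ev q = ev q * b.
Proof.
move=> ba; elim/poly_ind: q => [|q c IH]; first by rewrite rmorph0 mulr0 mul0r.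
rewrite rmorphD rmorphM /= horner_algX horner_algC mulrDr mulrDl.
by rewrite mulrA IH -!mulrA ba mulr_algr mulr_algl.
Qed.

Lemma ev_p q : p * ev q = ev q * p.
Proof. by apply: ev_comm; rewrite pa ap. Qed.

Lemma ev_star_comm q : cstar (ev q) * ev q = ev q * cstar (ev q).
Proof.
apply: ev_comm; have := congr1 cstar (ev_comm q (erefl (a * a))).
by rewrite !cstarM aS.
Qed.

Lemma selfadjoint_nilpotent (h : A) k : cstar h = h -> h ^+ (2 ^ k) = 0 -> h = 0.
Proof.
move=> hS; elim: k => [//|k IH] h0; apply: IH; apply: cstar_eq0.
have -> : cstar (h ^+ (2 ^ k)) = h ^+ (2 ^ k).
  elim: (2 ^ k)%N => [|l IHl]; first by rewrite expr0 cstar1.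
  by rewrite [in LHS]exprS cstarM IHl hS -exprSr.
by rewrite -exprD addnn -mul2n -expnS.
Qed.

Lemma normal_nilpotent (b : A) m :
  cstar b * b = b * cstar b -> b ^+ m = 0 -> b = 0.
Proof.
move=> bN bm; apply/cstar_eq0/(@selfadjoint_nilpotent _ m).
  by rewrite cstarM cstarK.
rewrite exprMn_comm; last by rewrite /GRing.comm bN.
have mk : (m <= 2 ^ m)%N by apply: ltnW; rewrite ltn_expl.
by rewrite -(subnKC mk) [b ^+ _]exprD bm mul0r mulr0.
Qed.

Lemma normal_idempotent (c : A) :
  cstar c * c = c * cstar c -> c * c = c -> cstar c = c.
Proof.
move=> cN cc.
have css : cstar c * cstar c = cstar c by rewrite -cstarM cc.
have h : c - c * cstar c = 0.
  have e1 : cstar c * (c * cstar c) = c * cstar c.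
    by rewrite mulrA cN -mulrA css.
  have e2 : c * cstar c * c = c * cstar c by rewrite -mulrA cN mulrA cc.
  apply: cstar_eq0; rewrite cstarB cstarM cstarK mulrBl !mulrBr e1 e2 cN.
  by rewrite -mulrA e1 mulrA cc !subrr.
have hc : c = c * cstar c by apply/eqP; rewrite -subr_eq0 h.
by rewrite {1}hc cstarM cstarK -hc.
Qed.

Lemma ev_annihilator : exists2 q : {poly R[i]}, q != 0 & p * ev q = 0.
Proof.
have [|c [[i ci] hc]] := @fd_dependent n0.+1 (fun i => p * a ^+ i) (ltnSn _).
  move=> i; apply: subalgM => //.
  by elim: (nat_of_ord i) => [|j IH]; rewrite ?expr0 ?exprS; [exact: subalg1|exact: subalgM].
exists (\sum_(i < n0.+1) c i *: 'X^i).
  apply: contraNneq ci => /(congr1 (fun q : {poly _} => q`_i)).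
  rewrite coef_sum coef0 (bigD1 i)//= coefZ coefXn eqxx mulr1 big1 ?addr0 => [->//|].
  move=> j ji; rewrite coefZ coefXn; case: eqP => [/val_inj/esym/eqP|]; last by rewrite mulr0.
  by rewrite (negPf ji).
rewrite raddf_sum /= mulr_sumr -[RHS]hc; apply: eq_bigr => j _.
by rewrite linearZ /= rmorphXn /= horner_algX mulr_algl -scalerAr.
Qed.

Lemma corner_selfadjoint_scalar : exists l : R[i], a = l *: p.
Proof.
have [pS pp] := pP.
have evM q r : p * ev (q * r) = (p * ev q) * (p * ev r).
  by rewrite rmorphM /= !mulrA -(mulrA p (ev q) p) -ev_p !mulrA pp.
pose S k := `[< exists q : {poly R[i]}, [/\ size q = k, q != 0 & p * ev q = 0] >].
have S1 : exists k, S k.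
  by have [q q0 hq] := ev_annihilator; exists (size q); apply/asboolP; exists q.
have [k /asboolP[q [qk q0 hq]] kmin] := ex_minnP S1.
have [l ql] : exists l, root q l.
  apply/closed_rootP; apply: contraNneq p0 => /eqP/size_poly1P[c c0 qc].
  move: hq; rewrite qc horner_algC mulr_algr => /eqP.
  by rewrite scaler_eq0 (negPf c0).
have [m [r /implyP/(_ q0) rl qr]] := multiplicity_XsubC q l.
have m0 : (0 < m)%N.
  by case: m qr => // qr; move: rl; rewrite -[r]mulr1 -(expr0 ('X - l%:P)) -qr ql.
have : coprimep r (('X - l%:P) ^+ m).
  by apply: coprimep_expr; rewrite coprimep_XsubC.
move=> /Bezout_eq1_coprimepP[[u v] /= uv].
pose c := p * ev (u * r).
have cc : c * c = c.
  rewrite /c -evM; apply/eqP; rewrite -subr_eq0 -mulrBr -rmorphB /=.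
  have -> : u * r * (u * r) - u * r = - (u * v) * q.
    rewrite qr -[X in _ - X]mulr1 -mulrBr -[X in _ - X]uv opprD addrA subrr add0r.
    by rewrite mulrN mulNr; congr (- _); rewrite -!mulrA [r * (v * _)]mulrCA.
  by rewrite evM hq mulr0.
have cN : cstar c * c = c * cstar c.
  have pEs : p * cstar (ev (u * r)) = cstar (ev (u * r)) * p.
    by rewrite -{1}pS -cstarM -ev_p cstarM pS.
  rewrite /c; move: (ev (u * r)) pEs (ev_p (u * r)) (ev_star_comm (u * r)).
  move=> E pEs pE EE; rewrite cstarM pS -[LHS]mulrA (mulrA p p) pp pE mulrA EE.
  by rewrite -[RHS]mulrA -pEs (mulrA p p) pp pEs mulrA.
have Fc : F c by apply: subalgM => //; exact: ev_in.
have pc : p * c = c by rewrite /c mulrA pp.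
have [c0|cp] := p_unsplit Fc (conj (normal_idempotent cN cc) cc) pc.
  have hr : p * ev r = 0.
    have e1 : p * ev (v * ('X - l%:P) ^+ m) = p.
      have := congr1 (fun w => p * ev w) uv.
      by rewrite rmorphD /= mulrDr -/c c0 add0r rmorph1 mulr1.
    have e2 : p * ev (v * q) = 0 by rewrite evM hq mulr0.
    have -> : p * ev r = p * ev (v * ('X - l%:P) ^+ m) * (p * ev r).
      by rewrite e1 mulrA pp.
    by rewrite -evM -mulrA [_ * r]mulrC -qr.
  have r0 : r != 0 by apply: contraNneq q0 => r0; rewrite qr r0 mul0r.
  have : S (size r) by apply/asboolP; exists r.
  move=> /kmin; rewrite -qk qr size_Mmonic ?monic_exp ?monicXsubC// size_exp_XsubC.
  by rewrite addnS /= -{2}[size r]addn0 leq_add2l leqNgt m0.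
have bm : p * ev (('X - l%:P) ^+ m) = 0.
  have : p * ev (('X - l%:P) ^+ m) * c = 0.
    by rewrite /c -evM mulrCA [_ * r]mulrC -qr evM hq mulr0.
  by rewrite cp -mulrA -ev_p mulrA pp.
pose b := a - l *: p; exists l; apply/eqP; rewrite -subr_eq0; apply/eqP.
have bS : cstar b = a - Num.conj l *: p by rewrite cstarB cstarZ aS pS.
apply: (@normal_nilpotent b m).
  rewrite bS /b !mulrBl !mulrBr -!(scalerAl, scalerAr) !(pp, ap, pa).
  rewrite !opprB !scalerA [l * _]mulrC addrACA [RHS]addrACA; congr (_ + _).
  by rewrite addrC.
have pb : p * ev ('X - l%:P) = b.
  by rewrite rmorphB /= horner_algX horner_algC mulrBr pa mulr_algr.
have pw j : p * ev (('X - l%:P) ^+ j.+1) = b ^+ j.+1.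
  by elim: j => [|j IH]; rewrite ?expr1// exprS evM pb IH -exprS.
by move: bm; rewrite -(prednK m0) pw.
Qed.

End Corner.

Definition minimal_proj (e : A) : Prop :=
  [/\ F e, is_proj e, e != 0 & forall a, F a -> exists l : R[i], e * a * e = l *: e].

Lemma unsplit_minimal p : F p -> is_proj p -> p != 0 -> unsplit p -> minimal_proj p.
Proof.
move=> Fp pP p0 pu; split=> // a Fa; have [pS pp] := pP.
have key b : F b -> cstar b = b -> exists l : R[i], p * b * p = l *: p.
  move=> Fb bS; apply: corner_selfadjoint_scalar => //.
  - by apply/subalgM => //; exact: subalgM.
  - by rewrite !cstarM bS pS mulrA.
  - by rewrite !mulrA pp.
  - by rewrite -!mulrA pp.
have Fs := subalgS Fsub Fa.
have [|l1 h1] := key (a + cstar a) (subalgD Fsub Fa Fs).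
  by rewrite cstarD cstarK addrC.
have [||l2 h2] := key ('i *: (a - cstar a)).
- by apply/subalgZ/subalgB.
- by rewrite cstarZ cstarB cstarK conjCi scaleNr -scalerN opprB.
exists (2^-1 * l1 - 2^-1 * 'i * l2).
have -> : a = 2^-1 *: (a + cstar a) - (2^-1 * 'i) *: ('i *: (a - cstar a)).
  rewrite scalerA -mulrA -expr2 sqrCi mulrN1 scaleNr opprK -scalerDr.
  by rewrite addrACA subrr addr0 -mulr2n -(scaler_nat 2 a :
    (2%:R : R[i]) *: a = _) scalerA mulVf ?scale1r.
rewrite mulrBr mulrBl -!(scalerAl, scalerAr).
have := h2; rewrite -!(scalerAl, scalerAr) => ->.
by rewrite h1 !scalerA -scalerBl.
Qed.

Lemma minimal_family : exists k (p : 'I_k -> A),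
  orth_family p /\ forall i, minimal_proj (p i).
Proof.
have [k [p [pf pu]]] := unsplit_family; exists k, p; split=> // i.
by have [pF pP p0 _ _] := pf; exact: unsplit_minimal.
Qed.

End FiniteDimensional.

(** * Traces *)

Section Minimal.
Context {R : realType} {A : cstarAlgType R} {F : set A} (Fsub : star_subalg F).
Local Notation minimal := (minimal_proj (F := F)).

Lemma scale_inj (e : A) (a b : R[i]) : e != 0 -> a *: e = b *: e -> a = b.
Proof.
move=> e0 /eqP; rewrite -subr_eq0 -scalerBl scaler_eq0 (negPf e0) orbF subr_eq0.
by move/eqP.
Qed.

(* If [x^* x] were a negative multiple of [e], a suitable combination
   [alpha e + x] would be a nonzero solution of [u^* u = 0]. *)
Lemma minimal_positive (e x : A) : minimal e -> F x -> x * e = x ->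
  exists2 r : R[i], 0 <= r & cstar x * x = r *: e.
Proof.
move=> [Fe [eS ee] e0 emin] Fx xe.
have ex : e * cstar x = cstar x by rewrite -[in LHS]eS -cstarM xe.
have [r hr] := emin (cstar x * x) (subalgM Fsub (subalgS Fsub Fx) Fx).
rewrite mulrA ex -mulrA xe in hr.
have rR : r \is Num.real.
  apply/CrealP/(scale_inj e0).
  by rewrite -hr -[RHS]cstarK [cstar (_ * _)]cstarM cstarK hr cstarZ eS.
exists r => //; move: rR; rewrite realE => /orP[//|r_le0].
have [l] := emin x Fx; rewrite -mulrA xe => hl.
have hl' : cstar x * e = Num.conj l *: e by rewrite -{1}eS -cstarM hl cstarZ eS.
pose mu : R[i] := if l == 0 then 1 else 'i * (l / `|l|).
have mu1 : mu * Num.conj mu = 1.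
  rewrite /mu; case: eqP => [_|/eqP l0]; first by rewrite conjC1 mulr1.
  rewrite -normCK normrM normCi mul1r normrM normfV normr_id divff ?expr1n//.
  by rewrite normr_eq0.
have mul : Num.conj mu * l + mu * Num.conj l = 0.
  rewrite /mu; case: eqP => [->|/eqP l0]; first by rewrite conjC0 !mulr0 addr0.
  rewrite rmorphM /= conjCi rmorphM /= fmorphV /= conj_normC.
  by ring.
pose s := sqrtC (- r).
have s0 : 0 <= s by rewrite sqrtC_ge0 oppr_ge0.
have sS : Num.conj s = s by apply/CrealP; exact: ger0_real.
have ss : s * s = - r by rewrite -expr2 sqrtCK.
have : (s * mu) *: e + x = 0.
  apply: cstar_eq0; rewrite cstarD cstarZ eS mulrDl !mulrDr.
  rewrite -!(scalerAl, scalerAr) ee hl hl' hr !scalerA -!scalerDl.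
  rewrite rmorphM /= sS (_ : _ + _ = 0) ?scale0r//.
  transitivity (s * s * (mu * mu^*) + s * (mu^* * l + mu * l^*) + r); first by ring.
  by rewrite ss mu1 mul mulr0 addr0 mulr1 addNr.
move=> /eqP; rewrite addrC addr_eq0 => /eqP xE.
have : cstar x * x = (- r) *: e.
  rewrite xE cstarN mulrNN cstarZ eS -!(scalerAl, scalerAr) ee scalerA rmorphM /= sS.
  by rewrite mulrACA ss [_ * mu]mulrC mu1 mulr1.
rewrite hr => /(scale_inj e0) /eqP; rewrite -addr_eq0 -mulr2n mulrn_eq0 /=.
by move=> /eqP ->.
Qed.

Lemma minimal_col_positive n (e : A) (x : 'cV[A]_n) : minimal e -> mx_in F x ->
  (forall i, x i 0 * e = x i 0) ->
  exists r : R[i], [/\ 0 <= r, (adjmx x *m x) 0 0 = r *: e & r = 0 -> x = 0].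
Proof.
move=> em Fx xe.
have h i : exists r : R[i], 0 <= r /\ cstar (x i 0) * x i 0 = r *: e.
  by have [r r0 hr] := minimal_positive em (Fx i 0) (xe i); exists r.
have [r hr] := choice h.
exists (\sum_i r i); split.
- by apply: sumr_ge0 => i _; have [] := hr i.
- rewrite mxE scaler_suml; apply: eq_bigr => i _.
  by rewrite mxE; have [] := hr i.
move=> /psumr_eq0P r0; apply/matrixP => i j; rewrite !mxE ord1.
apply: cstar_eq0; have [_ ->] := hr i; rewrite r0 ?scale0r// => k _.
by have [] := hr k.
Qed.

Section Trace.
Context {k : nat} {p : 'I_k -> A}.
Hypotheses (pf : orth_family (F := F) p) (pmin : forall i, minimal (p i)).

Definition linked (i j : 'I_k) : Prop := exists2 y, F y & p i * y * p j != 0.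

Lemma family_in i : F (p i). Proof. by case: pf. Qed.
Lemma family_star i : cstar (p i) = p i. Proof. by case: pf => _ h _ _ _; case: (h i). Qed.
Lemma family_idem i : p i * p i = p i. Proof. by case: pf => _ h _ _ _; case: (h i). Qed.
Lemma family_neq0 i : p i != 0. Proof. by case: pf. Qed.
Lemma family_orth i j : i != j -> p i * p j = 0. Proof. by case: pf => _ _ _ h _; exact: h. Qed.
Lemma family_sum : \sum_i p i = 1. Proof. by case: pf. Qed.

Lemma family_inM a i b : F a -> F b -> F (a * p i * b).
Proof. by move=> Fa Fb; apply/subalgM => //; apply/subalgM/family_in. Qed.

Lemma linked_refl i : linked i i.
Proof. by exists 1; [exact: subalg1|rewrite mulr1 family_idem family_neq0]. Qed.

Lemma linked_sym i j : linked i j -> linked j i.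
Proof.
move=> [y Fy y0]; exists (cstar y); first exact: subalgS.
apply: contraNneq y0 => /(congr1 cstar).
by rewrite !cstarM cstarK !family_star cstar0 mulrA => ->.
Qed.

Lemma linked_trans i j l : linked i j -> linked j l -> linked i l.
Proof.
move=> [y Fy y0] [z Fz z0]; exists (y * p j * z); first exact: family_inM.
have Fyj : F (p i * y * p j).
  by apply/subalgM/family_in => //; apply/subalgM => //; exact: family_in.
have yj : p i * y * p j * p j = p i * y * p j by rewrite -mulrA family_idem.
have [r r0 hr] := minimal_positive (pmin j) Fyj yj.
apply/eqP => h; have : cstar (p i * y * p j) * (p i * y * p j) * (z * p l) = 0.
  by rewrite -!mulrA in h *; rewrite h mulr0.
rewrite hr -scalerAl mulrA => /eqP; rewrite scaler_eq0 (negPf z0) orbF => /eqP rz.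
by move/negP: y0; apply; apply/eqP/cstar_eq0; rewrite hr rz scale0r.
Qed.

Definition coef (i : 'I_k) (a : A) : R[i] := xget 0 [set l | p i * a * p i = l *: p i].

Lemma coefP i a : F a -> p i * a * p i = coef i a *: p i.
Proof.
move=> Fa; have [_ _ _ h] := pmin i; have [l hl] := h a Fa.
exact: (@xgetPex _ 0 [set l | p i * a * p i = l *: p i]) (ex_intro _ l hl).
Qed.

Lemma coef_eq i a l : F a -> p i * a * p i = l *: p i -> coef i a = l.
Proof. by move=> Fa h; apply: (scale_inj (family_neq0 i)); rewrite -coefP. Qed.

Lemma coefD i a b : F a -> F b -> coef i (a + b) = coef i a + coef i b.
Proof.
move=> Fa Fb; apply: coef_eq; first exact: subalgD.
by rewrite mulrDr mulrDl !coefP// scalerDl.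
Qed.

Lemma coef_mulC i l a b : F a -> F b ->
  coef i (a * p l * b) = coef l (b * p i * a).
Proof.
move=> Fa Fb; have Fi := family_in i; have Fl := family_in l.
have Fab : F (a * p l * b) by exact: family_inM.
have Fba : F (b * p i * a) by exact: family_inM.
pose u := p i * a * p l; pose v := p l * b * p i.
have uv : u * v = coef i (a * p l * b) *: p i.
  rewrite -coefP// /u /v -!mulrA; congr (_ * (_ * _)).
  by rewrite !mulrA family_idem.
have vu : v * u = coef l (b * p i * a) *: p l.
  rewrite -coefP// /u /v -!mulrA; congr (_ * (_ * _)).
  by rewrite !mulrA family_idem.
have iu : p i * u = u by rewrite /u !mulrA family_idem.
have ul : u * p l = u by rewrite /u -!mulrA family_idem.
have [u0|u0] := eqVneq u 0.
  have z j c : 0 = c *: p j -> c = 0.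
    by move/esym/eqP; rewrite scaler_eq0 (negPf (family_neq0 j)) orbF => /eqP.
  by move: uv vu; rewrite u0 mulr0 mul0r => /z -> /z ->.
have : u * v * u = u * (v * u) by rewrite mulrA.
by rewrite uv vu -scalerAl -scalerAr iu ul => /(scale_inj u0).
Qed.

Lemma coef_unlinked i l a b : F a -> F b -> ~ linked i l ->
  coef i (a * p l * b) = 0.
Proof.
move=> Fa Fb il; apply: coef_eq; first exact: family_inM.
have -> : p i * (a * p l * b) * p i = p i * a * p l * (b * p i) by rewrite !mulrA.
have [->|u0] := eqVneq (p i * a * p l) 0; first by rewrite mul0r scale0r.
by case: il; exists a.
Qed.

Definition trace j a := \sum_(i | `[< linked i j >]) coef i a.

Lemma traceD j a b : F a -> F b -> trace j (a + b) = trace j a + trace j b.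
Proof.
by move=> Fa Fb; rewrite -big_split; apply: eq_bigr => i _; exact: coefD.
Qed.

Lemma trace0 j : trace j 0 = 0.
Proof.
rewrite /trace big1// => i _; apply: coef_eq; first exact: subalg0.
by rewrite mulr0 mul0r scale0r.
Qed.

Lemma trace_sum (I : Type) (s : seq I) (P : pred I) (G : I -> A) j :
  (forall i, F (G i)) ->
  trace j (\sum_(i <- s | P i) G i) = \sum_(i <- s | P i) trace j (G i).
Proof.
move=> FG; elim: s => [|i s IH]; first by rewrite !big_nil trace0.
rewrite !big_cons; case: ifP => // _.
by rewrite traceD ?IH//; exact: subalg_sum.
Qed.

Lemma trace_mul j a b : F a -> F b ->
  trace j (a * b) = \sum_(i | `[< linked i j >]) \sum_(l | `[< linked l j >]) coef i
    (a * p l * b).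
Proof.
move=> Fa Fb; apply: eq_bigr => i /asboolP ij.
have -> : a * b = \sum_l a * p l * b by rewrite -mulr_suml -mulr_sumr family_sum mulr1.
have Fl l : F (a * p l * b) by exact: family_inM.
rewrite [RHS]big_mkcond /=.
rewrite (_ : coef i _ = \sum_l coef i (a * p l * b)).
  apply: eq_bigr => l _; case: asboolP => // lj; apply: coef_unlinked => // il.
  by apply: lj; apply: linked_trans ij; exact: linked_sym.
elim: (index_enum _) => [|l s IH]; last by rewrite !big_cons coefD ?IH//; exact: subalg_sum.
rewrite !big_nil; apply: coef_eq; first exact: subalg0.
by rewrite mulr0 mul0r scale0r.
Qed.

Lemma trace_mulC j a b : F a -> F b -> trace j (a * b) = trace j (b * a).
Proof.
move=> Fa Fb; rewrite !trace_mul// exchange_big; apply: eq_bigr => i _.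
by apply: eq_bigr => l _; exact: coef_mulC.
Qed.

Lemma trace_family j i : trace j (p i) = (`[< linked i j >] : nat)%:R.
Proof.
have cii : coef i (p i) = 1.
  by apply: coef_eq; [exact: family_in|rewrite !family_idem scale1r].
have cli l : l != i -> coef l (p i) = 0.
  move=> li; apply: coef_eq; first exact: family_in.
  by rewrite family_orth// mul0r scale0r.
rewrite /trace; case: asboolP => [ij|ij].
  rewrite (bigD1 i) ?cii/=; last exact/asboolP.
  by rewrite big1 ?addr0// => l /andP[_]; exact: cli.
rewrite big1// => l /asboolP lj; apply: cli.
by apply: contra_notN ij => /eqP <-.
Qed.

Definition mxtr j n (M : 'M[A]_n) : R[i] := \sum_i trace j (M i i).

Lemma mxtrD j n (M N : 'M[A]_n) : mx_in F M -> mx_in F N ->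
  mxtr j (M + N) = mxtr j M + mxtr j N.
Proof.
by move=> FM FN; rewrite -big_split; apply: eq_bigr => i _; rewrite mxE traceD.
Qed.

Lemma mxtr_mulC j m n (M : 'M[A]_(m, n)) (N : 'M[A]_(n, m)) :
  mx_in F M -> mx_in F N -> mxtr j (M *m N) = mxtr j (N *m M).
Proof.
move=> FM FN; rewrite /mxtr.
have FMN i l : F (M i l * N l i) by exact: subalgM.
have FNM i l : F (N i l * M l i) by exact: subalgM.
under eq_bigr do rewrite mxE trace_sum//.
under [RHS]eq_bigr do rewrite mxE trace_sum//.
by rewrite exchange_big; apply: eq_bigr => i _; apply: eq_bigr => l _; exact: trace_mulC.
Qed.

Lemma mxtr_block j m n (M : 'M[A]_m) (N : 'M[A]_n) :
  mxtr j (block_mx M 0 0 N) = mxtr j M + mxtr j N.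
Proof.
rewrite /mxtr big_split_ord /=; congr (_ + _); apply: eq_bigr => i _.
  by rewrite block_mxEul.
by rewrite block_mxEdr.
Qed.

End Trace.
End Minimal.

(** * Cancellation in finite dimension *)

Section MatrixProjections.
Context {R : realType} {A : cstarAlgType R}.

Lemma pmx_adj (p : projection A) : adjmx ((p : A)%:M : 'M[A]_1) = (p : A)%:M.
Proof. by apply/matrixP => i j; rewrite !mxE !ord1 eqxx pr_star. Qed.

Lemma pmx_idem (p : projection A) : ((p : A)%:M : 'M[A]_1) *m (p : A)%:M = (p : A)%:M.
Proof. by rewrite -scalar_mxM pr_idem. Qed.

Definition pmx (p : projection A) : mxprojection A :=
  MxProjection (pmx_adj p) (pmx_idem p).

Lemma mx11_eq (M N : 'M[A]_1) : M 0 0 = N 0 0 -> M = N.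
Proof. by move=> h; apply/matrixP => i j; rewrite !ord1. Qed.

Lemma mxmvn_class_orth n (P P1 P2 : 'M[A]_n) (Pa : adjmx P = P) (Pi : P *m P = P)
    (P1a : adjmx P1 = P1) (P1i : P1 *m P1 = P1) (P2a : adjmx P2 = P2)
    (P2i : P2 *m P2 = P2) :
  P1 *m P2 = 0 -> P1 + P2 = P ->
  mxmvn_class (MxProjection Pa Pi) =
  mxmvn_class (MxProjection P1a P1i) + mxmvn_class (MxProjection P2a P2i).
Proof.
move=> P12 PE; have P21 : P2 *m P1 = 0.
  by rewrite -P1a -P2a -adjmxM P12 adjmx0.
apply/esym; transitivity (mxmvn_class (dsum (MxProjection P1a P1i) (MxProjection P2a P2i))).
  exact: mvn_addE.
apply/mxmvn_classP; exists (row_mx P1 P2).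
rewrite adjmx_row P1a P2a mul_col_row mul_row_col P1i P2i P12 P21 PE.
by split.
Qed.

Lemma mxmvn_class0 n (Pa : adjmx (0 : 'M[A]_n) = 0) (Pi : (0 : 'M[A]_n) *m 0 = 0) :
  mxmvn_class (MxProjection Pa Pi) = 0.
Proof. by apply/mxmvn_classP; exists 0; rewrite adjmx0 !mulmx0; split. Qed.

(* Without positivity in the matrix algebras, [v = v P] is not automatic: [v] is
   replaced with [v P]. *)
Lemma mxmvn_eq_corner (P Q : mxprojection A) : mxmvn_eq P Q ->
  exists v : 'M[A]_(mxpr_size Q, mxpr_size P),
    [/\ adjmx v *m v = P, v *m adjmx v = Q, v *m P = v & mxpr_val Q *m v = v].
Proof.
move=> [v [vP vQ]]; exists (v *m P); have Pi := mxpr_idem P.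
rewrite adjmxM mxpr_adj; split.
- by rewrite -mulmxA (mulmxA _ v) vP !Pi.
- rewrite -mulmxA (mulmxA (mxpr_val P)) Pi -vP -!mulmxA vQ mulmxA vQ.
  exact: mxpr_idem.
- by rewrite -mulmxA Pi.
- by rewrite -vQ -!mulmxA (mulmxA (adjmx v)) vP Pi.
Qed.

End MatrixProjections.

Section Decomposition.
Context {R : realType} {A : cstarAlgType R} {F : set A} (Fsub : star_subalg F).
Context {k : nat} {p : 'I_k -> A}.
Hypotheses (pf : orth_family (F := F) p) (pmin : forall i, minimal_proj (F := F) (p i)).

Definition fproj i : projection A := Projection (family_star pf i) (family_idem pf i).

Local Notation link j := (fun i => `[< linked (F := F) (p := p) i j >]).

Definition decomposed n (P : 'M[A]_n) (s : seq 'I_k) : Prop :=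
  (forall j, mxtr (F := F) (p := p) j P = (count (link j) s)%:R) /\
  forall Pa Pi, mxmvn_class (@MxProjection _ _ _ P Pa Pi) =
    \sum_(i <- s) mxmvn_class (pmx (fproj i)).

(* Gram-Schmidt on the columns of [L], which need only detect the nonzero
   subprojections of [P]: no dimension is counted. *)
Lemma gram_schmidt n (L : seq ('cV[A]_n * 'I_k)) (P : 'M[A]_n) :
  mx_in F P -> adjmx P = P -> P *m P = P ->
  (forall c, c \in L -> mx_in F c.1 /\ c.1 *m (p c.2)%:M = c.1) ->
  (forall Q : 'M[A]_n, adjmx Q = Q -> Q *m Q = Q -> P *m Q = Q ->
    (forall c, c \in L -> Q *m c.1 = 0) -> Q = 0) ->
  exists s, decomposed P s.
Proof.
elim: L P => [|[c i] L IH] P FP Pa Pi hL hQ.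
  exists [::]; have -> : P = 0 by apply: hQ.
  split=> [j|Qa Qi]; last by rewrite big_nil mxmvn_class0.
  by rewrite /mxtr big1// => l _; rewrite mxE; exact: trace0.
have [/= Fc ci] := hL (c, i) (mem_head _ _).
have hL' d : d \in L -> mx_in F d.1 /\ d.1 *m (p d.2)%:M = d.1.
  by move=> dL; apply: hL; rewrite inE dL orbT.
have QP (Q : 'M[A]_n) : adjmx Q = Q -> P *m Q = Q -> Q *m P = Q.
  by move=> Qa PQ; rewrite -[in LHS]Qa -Pa -adjmxM PQ.
have [Pc0|Pc0] := eqVneq (P *m c) 0.
  apply: IH => // Q Qa Qi PQ hc; apply: hQ => // d; rewrite inE => /orP[/eqP->/=|/hc//].
  by rewrite -(QP Q)// -mulmxA Pc0 mulmx0.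
pose y := P *m c; have Fy : mx_in F y by exact: mx_inM.
have ye : y *m (p i)%:M = y by rewrite /y -mulmxA ci.
have ye' l : y l 0 * p i = y l 0.
  have := congr1 (fun M : 'cV[A]_n => M l 0) ye; rewrite !mxE big_ord1 !mxE eqxx mulr1n.
  by [].
have [r0 [r0_ge0 hr r0_eq0]] := minimal_col_positive Fsub (pmin i) Fy ye'.
have [r rE] : exists r : R, r0 = r%:C.
  by exists (complex.Re r0); rewrite RRe_real// ger0_real.
rewrite {}rE in r0_ge0 hr r0_eq0.
have r_gt0 : 0 < r.
  rewrite lt_def -lecR r0_ge0 andbT; apply: contraNneq Pc0 => r0'.
  by apply/eqP/r0_eq0; rewrite r0'.
have yy : adjmx y *m y = cmx r (p i)%:M.
  by apply: mx11_eq; rewrite hr !mxE eqxx mulr1n.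
pose t := (Num.sqrt r)^-1; have tr : t * t * r = 1.
  rewrite /t -invfM -expr2 sqr_sqrtr ?ltW// mulVf// gt_eqF//.
pose x := cmx t y; have Fx : mx_in F x by exact: mx_in_cmx.
have xx : adjmx x *m x = (p i)%:M.
  by rewrite adj_cmx cmx_mull cmx_mulr yy !cmx_cmx tr cmx1.
have xe : x *m (p i)%:M = x by rewrite cmx_mull ye.
have Px : P *m x = x by rewrite cmx_mulr mulmxA Pi.
pose E := x *m adjmx x.
have Ea : adjmx E = E by rewrite adjmxM adjmxK.
have Ei : E *m E = E by rewrite /E -mulmxA (mulmxA (adjmx x)) xx mulmxA xe.
have PE : P *m E = E by rewrite mulmxA Px.
have EP : E *m P = E by exact: QP.
pose P1 := P - E.
have P1a : adjmx P1 = P1 by rewrite adjmxB Pa Ea.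
have P1i : P1 *m P1 = P1 by rewrite mulmxBl !mulmxBr Pi PE EP Ei subrr subr0.
have FE : mx_in F E by apply: mx_inM => //; exact: mx_in_adj.
have FP1 : mx_in F P1 by exact: mx_inB.
have P1c : P1 *m c = 0.
  have yE : y = cmx (t * r) x by rewrite /x cmx_cmx mulrAC tr cmx1.
  have -> : P1 *m c = y - x *m (adjmx x *m c) by rewrite mulmxBl -mulmxA.
  have -> : adjmx x *m c = adjmx x *m y.
    by rewrite /y mulmxA -[in RHS]Pa -adjmxM Px.
  by rewrite [in X in _ - X]yE cmx_mulr xx cmx_mulr xe -yE subrr.
have PP1 : P *m P1 = P1 by rewrite mulmxBr Pi PE.
have [|s [s1 s2]] := IH P1 FP1 P1a P1i hL'.
  move=> Q Qa Qi P1Q hc; apply: hQ => //; first by rewrite -P1Q mulmxA PP1.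
  move=> d; rewrite inE => /orP[/eqP->/=|/hc//].
  have -> : Q = Q *m P1 by rewrite -[in RHS]Qa -P1a -adjmxM P1Q Qa.
  by rewrite -mulmxA P1c mulmx0.
exists (i :: s); split=> [j|Qa Qi].
  have -> : P = E + P1 by rewrite addrC subrK.
  rewrite (mxtrD Fsub pf pmin)// s1 /= natrD; congr (_ + _).
  rewrite (mxtr_mulC Fsub pf pmin)//; last exact: mx_in_adj.
  by rewrite xx /mxtr big_ord1 mxE eqxx mulr1n (trace_family pf pmin).
rewrite (@mxmvn_class_orth _ _ _ P E P1 Qa Qi Ea Ei P1a P1i); last 2 first.
- by rewrite mulmxBr EP Ei subrr.
- by rewrite addrC subrK.
rewrite big_cons s2; congr (_ + _).
by apply/esym/mxmvn_classP; exists x.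
Qed.

Lemma decomposition n (P : 'M[A]_n) :
  mx_in F P -> adjmx P = P -> P *m P = P -> exists s, decomposed P s.
Proof.
move=> FP Pa Pi.
apply: (gram_schmidt (L := [seq (delta_mx l 0 *m
  (p i)%:M, i) | l <- enum 'I_n, i <- enum 'I_k])) => //.
  move=> _ /allpairsP[[l i] [_ _ ->]] /=; split.
    move=> a b; rewrite mxE; apply: subalg_sum => // o _; rewrite !mxE.
    apply: subalgM => //.
      by case: (_ && _); [exact: subalg1|exact: subalg0].
    case: (_ == _); rewrite ?mulr1n ?mulr0n; [exact: (family_in pf)|exact: subalg0].
  by rewrite -mulmxA -scalar_mxM (family_idem pf).
move=> Q Qa Qi PQ hQ; apply/matrixP => a b; rewrite mxE -[LHS]mulr1 -(family_sum pf).
rewrite mulr_sumr big1// => i _.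
have := hQ (delta_mx b 0 *m (p i)%:M, i) _.
rewrite mulmxA -colE => /(_ _) h.
have := congr1 (fun M : 'cV[A]_n => M a 0) (h _); rewrite !mxE big_ord1 !mxE eqxx mulr1n; apply.
by apply/allpairsP; exists (b, i); rewrite !mem_enum.
Qed.

Lemma count_linked_sum (V : nmodType) (g : 'I_k -> V) (s t : seq 'I_k) :
  (forall i j, linked (F := F) (p := p) i j -> g i = g j) ->
  (forall j, count (link j) s = count (link j) t) ->
  \sum_(i <- s) g i = \sum_(i <- t) g i.
Proof.
move=> hg; elim: s t => [|i s IH] t hst.
  case: t hst => [//|j t /(_ j)] /=; rewrite asboolT//.
  exact: (linked_refl Fsub pf).
have : has (link i) t.
  by rewrite has_count -hst /= asboolT//; exact: (linked_refl Fsub pf).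
move=> /hasP[j jt /asboolP ji]; rewrite big_cons (big_rem j jt) /= (hg j i ji).
congr (_ + _); apply: IH => l.
have := hst l; rewrite (seq.permP (perm_to_rem jt)) /=.
suff -> : link l j = link l i by move/addnI.
apply/asboolP/asboolP => h; last exact: (linked_trans Fsub pf pmin) ji h.
by apply: (linked_trans Fsub pf pmin) h; exact: (linked_sym Fsub pf).
Qed.

Lemma linked_class i j : linked (F := F) (p := p) i j ->
  mxmvn_class (pmx (fproj i)) = mxmvn_class (pmx (fproj j)).
Proof.
move=> [y Fy y0].
pose x := p i * y * p j.
have Fx : F x by apply/subalgM/(family_in pf) => //; apply/subalgM => //; exact: (family_in pf).
have xj : x * p j = x by rewrite -mulrA (family_idem pf).
have ix : p i * x = x by rewrite /x !mulrA (family_idem pf).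
have xi : cstar x * p i = cstar x by rewrite -{1}(family_star pf i) -cstarM ix.
have [r r0 hr] := minimal_positive Fsub (pmin j) Fx xj.
have [] := minimal_positive Fsub (pmin i) (subalgS Fsub Fx) xi.
rewrite cstarK => r' r'0 hr'.
have rr' : r = r'.
  have : x * (cstar x * x) = x * cstar x * x by rewrite mulrA.
  by rewrite hr hr' -scalerAl -scalerAr xj ix => /(scale_inj y0).
have rn0 : r != 0.
  apply: contraNneq y0 => r0'; apply/eqP/cstar_eq0.
  by rewrite hr r0' scale0r.
pose t := (sqrtC r)^-1.
have t0 : 0 <= t by rewrite invr_ge0 sqrtC_ge0.
have tS : Num.conj t = t by apply/CrealP; exact: ger0_real.
have tt : t * t * r = 1 by rewrite /t -invfM -expr2 sqrtCK mulVf.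
apply/esym/mxmvn_classP; exists (t *: x)%:M.
by split; apply: mx11_eq; rewrite !mxE big_ord1 !mxE !eqxx !mulr1n cstarZ tS
  -scalerAl -scalerAr scalerA ?hr ?hr' -?rr' scalerA tt scale1r.
Qed.

Lemma mxtr_class (P Q : mxprojection A) : mx_in F P -> mx_in F Q ->
  (forall j, mxtr (F := F) (p := p) j P = mxtr (F := F) (p := p) j Q) ->
  mxmvn_class P = mxmvn_class Q.
Proof.
case: P => m P Pa Pi; case: Q => n Q Qa Qi /= FP FQ hPQ.
have [s [s1 s2]] := decomposition FP Pa Pi.
have [t [t1 t2]] := decomposition FQ Qa Qi.
rewrite s2 t2; apply: count_linked_sum; first exact: linked_class.
by move=> j; have := hPQ j; rewrite s1 t1 => /eqP; rewrite eqr_nat => /eqP.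
Qed.

Lemma finite_cancel (P Q N : mxprojection A) v :
  mx_in F P -> mx_in F Q -> mx_in F N -> mx_in F v ->
  adjmx v *m v = dsum P N -> v *m adjmx v = dsum Q N ->
  mxmvn_class P = mxmvn_class Q.
Proof.
move=> FP FQ FN Fv v1 v2; apply: mxtr_class => // j.
have := mxtr_mulC Fsub pf pmin j (mx_in_adj Fsub Fv) Fv.
by rewrite v1 v2 !mxtr_block => /addIr.
Qed.

End Decomposition.

(** * Cancellation in AF algebras *)

Section AFCancellation.
Context {R : realType} {A : cstarAlgType R}.

Lemma fd_star_subalg (F : set A) : fd_cstar_subalg F -> star_subalg F.
Proof.
move=> [F1 FM FS [n [e FE]]]; split=> //; rewrite FE.
- exact: cspanD.
- exact: cspanZ.
Qed.

Lemma fd_closed (F : set A) : fd_cstar_subalg F -> cclosed F.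
Proof. by move=> [_ _ _ [n [e ->]]]; exact: cspan_closed. Qed.

Lemma fd_cancel (F : set A) (P Q N : mxprojection A) v : fd_cstar_subalg F ->
  mx_in F P -> mx_in F Q -> mx_in F N -> mx_in F v ->
  adjmx v *m v = dsum P N -> v *m adjmx v = dsum Q N ->
  mxmvn_class P = mxmvn_class Q.
Proof.
move=> Ffd; have Fsub := fd_star_subalg Ffd.
have [_ _ _ [n [e FE]]] := Ffd.
have [|k [p [pf pmin]]] := minimal_family Fsub (e0 := e); first by rewrite {1}FE.
exact: (finite_cancel Fsub pf pmin).
Qed.

Lemma adj_mul_dist m n (v w : 'M[A]_(m, n)) :
  mxnorm (adjmx v *m v - adjmx w *m w) <= mxnorm (v - w) * (mxnorm v + mxnorm w).
Proof.
have -> : adjmx v *m v - adjmx w *m w = adjmx v *m (v - w) + adjmx (v - w) *m w.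
  by rewrite adjmxB mulmxBr mulmxBl addrA subrK.
apply: le_trans (mxnormD _ _) _; rewrite mulrDr; apply: lerD.
  by apply: le_trans (mxnormM _ _) _; rewrite mxnorm_adj mulrC.
by apply: le_trans (mxnormM _ _) _; rewrite mxnorm_adj.
Qed.

Context {F : nat -> set A}.
Hypotheses (Ffd : forall k, fd_cstar_subalg (F k)).
Hypotheses (FS : forall k, F k `<=` F k.+1).
Hypotheses (Fdense : forall (a : A) (e : R), 0 < e ->
          exists2 b, (\bigcup_k F k) b & cnorm (a - b) < e).

Lemma AF_mono k l : (k <= l)%N -> F k `<=` F l.
Proof.
move=> /subnKC <-; elim: (l - k)%N => [|j IH]; first by rewrite addn0.
by rewrite addnS => a /IH; exact: FS.
Qed.

Lemma mx_in_sub (F1 F2 : set A) m n (M : 'M[A]_(m, n)) :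
  F1 `<=` F2 -> mx_in F1 M -> mx_in F2 M.
Proof. by move=> h hM i j; exact/h/hM. Qed.

Lemma mx_approx m n (M : 'M[A]_(m, n)) (e : R) k0 : 0 < e ->
  exists k (N : 'M[A]_(m, n)), [/\ (k0 <= k)%N, mx_in (F k) N & mxnorm (M - N) <= e].
Proof.
move=> e0; pose d := e / ((m * n)%:R + 1).
have mn0 : 0 < (m * n)%:R + 1 :> R by rewrite ltr_wpDl.
have d0 : 0 < d by rewrite divr_gt0.
have h (ij : 'I_m * 'I_n) : exists kb : nat * A,
    F kb.1 kb.2 /\ cnorm (M ij.1 ij.2 - kb.2) < d.
  by have [b [k _ Fb] hb] := Fdense (M ij.1 ij.2) d0; exists (k, b).
have [f hf] := choice h.
pose k := maxn k0 (\max_ij (f ij).1).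
exists k, (\matrix_(i, j) (f (i, j)).2); split.
- exact: leq_maxl.
- move=> i j; rewrite mxE; have [Ff _] := hf (i, j); apply: AF_mono Ff.
  by apply: leq_trans (leq_maxr _ _); exact: (leq_bigmax (i, j)).
apply: (@le_trans _ _ ((m * n)%:R * d)).
  by apply: mxnorm_le => i j; rewrite !mxE; have [_ /ltW] := hf (i, j).
rewrite /d mulrCA ler_piMr ?(ltW e0)// ler_pdivrMr// mul1r lerDl.
exact: ler01.
Qed.

Lemma half_cmx m n (M : 'M[A]_(m, n)) : cmx 2^-1 M + cmx 2^-1 M = M.
Proof. rewrite -cmxDl (_ : 2^-1 + 2^-1 = 1 :> R) ?cmx1//; lra. Qed.

Lemma mx_projection_approx n (P : 'M[A]_n) (d : R) k0 :
  0 < d -> adjmx P = P -> P *m P = P ->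
  exists k (P0 : 'M[A]_n), [/\ (k0 <= k)%N, mx_in (F k) P0, adjmx P0 = P0,
     P0 *m P0 = P0 & mxnorm (P - P0) <= d].
Proof.
move=> d0 Pa Pi; pose W : 'M[A]_n := P + P - 1%:M.
have Wa : adjmx W = W by rewrite adjmxB adjmxD Pa adjmx1.
have WW : W *m W = 1%:M.
  rewrite [LHS]mulmxBl mul1mx [X in X - _]mulmxBr mulmx1 mulmxDl mulmxDr Pi addrK.
  by rewrite opprB addrC subrK.
pose B := mxnorm W; have B0 : 0 <= B by exact: mxnorm_ge0.
pose N : R := (n * n)%:R; have N0 : 0 <= N by exact: ler0n.
pose K := 1 + 2 * B + N * (2 * ((B + 1) * (1 + 2 * B))).
have K1 : 1 <= K.
  by rewrite /K -addrA lerDl addr_ge0// !mulr_ge0// addr_ge0// mulr_ge0.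
have K0 : 0 < K by exact: lt_le_trans K1.
pose e := Num.min 2^-1 d / K.
have m0 : 0 < Num.min 2^-1 d by rewrite lt_min d0 andbT invr_gt0.
have e0 : 0 < e by rewrite divr_gt0.
have [k [M [k0k FM hM]]] := mx_approx W k0 e0.
pose w := cmx 2^-1 (M + adjmx M).
have Fsub := fd_star_subalg (Ffd k).
have Fw : mx_in (F k) w by apply/mx_in_cmx/mx_inD => //; exact: mx_in_adj.
have wa : adjmx w = w by rewrite adj_cmx adjmxD adjmxK addrC.
have hw : mxnorm (W - w) <= e.
  have -> : W - w = cmx 2^-1 ((W - M) + adjmx (W - M)).
    by rewrite adjmxB Wa addrACA -opprD cmxD cmxN cmxD half_cmx.
  rewrite mxnorm_cmx ger0_norm//; have := mxnormD (W - M) (adjmx (W - M)).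
  by rewrite mxnorm_adj; lra.
have e_half : e * (1 + 2 * B) <= 2^-1.
  apply: (@le_trans _ _ (e * K)).
    rewrite ler_wpM2l ?(ltW e0)// /K lerDl !mulr_ge0// ?addr_ge0// mulr_ge0//.
  by rewrite /e divfK ?gt_eqF// ge_min lexx.
have e1 : e <= 1.
  apply: (@le_trans _ _ (e * (1 + 2 * B))); last by lra.
  by rewrite ler_peMr ?(ltW e0)// lerDl mulr_ge0.
have wB : mxnorm w <= B + 1.
  have -> : w = W - (W - w) by rewrite subKr.
  by apply: le_trans (mxnormD _ _) _; rewrite mxnormN -/B lerD2l; exact: le_trans e1.
have hww : mxnorm (1%:M - w *m w) <= e * (1 + 2 * B).
  have := adj_mul_dist W w; rewrite Wa wa WW => h; apply: le_trans h _.
  by rewrite ler_pM ?mxnorm_ge0 ?addr_ge0 ?mxnorm_ge0// -/B; lra.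
have [s [Fs sa ss hs]] := near_symmetry Fsub (fd_closed (Ffd k)) Fw wa (le_trans hww e_half).
have hs' : mxnorm (W - s) <= d.
  apply: le_trans (mxnorm_dist w _ _) _.
  apply: (@le_trans _ _ (e * K)); last first.
    by rewrite /e divfK ?gt_eqF// ge_min lexx orbT.
  rewrite /K -(addrA 1) [leRHS]mulrDr mulr1 lerD//; apply: le_trans hs _.
  rewrite -/N [leRHS]mulrDr; apply: ler_wpDl; first by rewrite mulr_ge0 ?(ltW e0)// mulr_ge0.
  rewrite [leRHS]mulrCA ler_wpM2l// [leRHS]mulrCA ler_wpM2l//.
  by rewrite [leRHS]mulrCA ler_pM ?mxnorm_ge0.
exists k, (cmx 2^-1 (1%:M + s)); split=> //.
- by apply/mx_in_cmx/mx_inD => //; exact: mx_in1.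
- by rewrite adj_cmx adjmxD adjmx1 sa.
- rewrite cmx_mull cmx_mulr mulmxDl !mulmxDr ss mulmx1 mul1mx !mulmx1.
  by rewrite [s + _]addrC cmxD half_cmx.
have -> : P - cmx 2^-1 (1%:M + s) = cmx 2^-1 (W - s).
  by rewrite -{1}(half_cmx P) -cmxD -cmxN -cmxD /W opprD addrA.
rewrite mxnorm_cmx ger0_norm//; have := mxnorm_ge0 (W - s); lra.
Qed.

Lemma near_projections_class n (P Q : 'M[A]_n) (Pa : adjmx P = P)
    (Pi : P *m P = P) (Qa : adjmx Q = Q) (Qi : Q *m Q = Q) :
  mxnorm (P - Q) * (mxnorm P ^+ 2) <= 2^-1 ->
  mxnorm (P - Q) * (mxnorm Q ^+ 2) <= 2^-1 ->
  mxmvn_class (MxProjection Pa Pi) = mxmvn_class (MxProjection Qa Qi).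
Proof.
have key (S T : 'M[A]_n) : adjmx S = S -> S *m S = S -> adjmx T = T -> T *m T = T ->
    mxnorm (S - adjmx (T *m S) *m (T *m S)) <= mxnorm (S - T) * (mxnorm S ^+ 2).
  move=> Sa Si Ta Ti.
  have -> : S - adjmx (T *m S) *m (T *m S) = S *m (S - T) *m S.
    by rewrite adjmxM Sa Ta -mulmxA (mulmxA T) Ti mulmxA mulmxBr mulmxBl !Si.
  apply: le_trans (mxnormM _ _) _; rewrite expr2 mulrA ler_wpM2r ?mxnorm_ge0//.
  by apply: le_trans (mxnormM _ _) _; rewrite mulrC.
move=> h1 h2; apply/mxmvn_classP.
have [] := near_partial_isometry (F := [set: A]) (P := P) (Q := Q) (w := Q *m P) => //.
- by rewrite -mulmxA Pi.
- by rewrite mulmxA Qi.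
- exact: le_trans (key _ _ _ _ _ _) _.
- have := key Q P Qa Qi Pa Pi; rewrite !adjmxM Pa Qa => h.
  by rewrite mxnormB in h2; exact: le_trans h2.
by move=> v [_ v1 v2]; exists v.
Qed.

Lemma AF_projection (P : mxprojection A) k0 :
  exists k (Q : mxprojection A), [/\ (k0 <= k)%N, mx_in (F k) Q &
    mxmvn_class P = mxmvn_class Q].
Proof.
case: P => n P Pa Pi; pose B := mxnorm P + 1.
have B1 : 1 <= B by rewrite lerDr mxnorm_ge0.
have B0 : 0 < B by exact: lt_le_trans B1.
have B20 : 0 < 2 * B ^+ 2 by rewrite mulr_gt0// exprn_gt0.
pose d := (2 * B ^+ 2)^-1; have d0 : 0 < d by rewrite invr_gt0.
have dB : d * B ^+ 2 = 2^-1 by rewrite /d invfM -mulrA mulVf ?mulr1// gt_eqF ?exprn_gt0.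
have d1 : d <= 1.
  rewrite invf_le1//; apply: (@le_trans _ _ (1 * 1)); first by rewrite mulr1.
  by rewrite ler_pM ?ler1n// exprn_ege1.
have [k [Q [k0k FQ Qa Qi hQ]]] := mx_projection_approx k0 d0 Pa Pi.
exists k, (MxProjection Qa Qi); split=> //.
have QB : mxnorm Q <= B.
  have -> : Q = P - (P - Q) by rewrite subKr.
  by apply: le_trans (mxnormD _ _) _; rewrite mxnormN lerD2l; exact: le_trans d1.
have sq x : 0 <= x -> x <= B -> x ^+ 2 <= B ^+ 2.
  by move=> x0 xB; rewrite lerXn2r// nnegrE// ltW.
apply: near_projections_class; rewrite -dB ler_pM ?mxnorm_ge0 ?exprn_ge0 ?mxnorm_ge0//.
  by rewrite sq ?mxnorm_ge0// lerDl.
by rewrite sq ?mxnorm_ge0.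
Qed.

Lemma AF_isometry (k0 : nat) (P Q : mxprojection A) :
  mx_in (F k0) P -> mx_in (F k0) Q -> mxmvn_eq P Q ->
  exists k (v : 'M[A]_(mxpr_size Q, mxpr_size P)), [/\ (k0 <= k)%N, mx_in (F k) v,
    adjmx v *m v = P & v *m adjmx v = Q].
Proof.
case: P Q => m P Pa Pi [n Q Qa Qi] /= FP FQ /mxmvn_eq_corner/= [v [v1 v2 vP Qv]].
pose B := mxnorm v; have B0 : 0 <= B by exact: mxnorm_ge0.
pose S := mxnorm Q * mxnorm P; have S0 : 0 <= S by rewrite mulr_ge0 ?mxnorm_ge0.
have KB0 : 0 < 2 * (2 * B + 1) by rewrite mulr_gt0// ltr_wpDl// mulr_ge0.
pose d := (2 * (2 * B + 1))^-1; have d0 : 0 < d by rewrite invr_gt0.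
have d1 : d <= 1 by rewrite invf_le1//; lra.
have dB : d * (2 * B + 1) = 2^-1.
  by rewrite /d invfM -mulrA mulVf ?mulr1// gt_eqF// ltr_wpDl// mulr_ge0.
have S10 : 0 < S + 1 by rewrite ltr_wpDl.
have [k [M [k0k FM hM]]] := mx_approx v k0 (divr_gt0 d0 S10).
pose w := Q *m M *m P.
have hw : mxnorm (v - w) <= d.
  have -> : v - w = Q *m (v - M) *m P by rewrite mulmxBr mulmxBl Qv vP.
  apply: le_trans (mxnormM _ _) _; rewrite mulrC.
  apply: (@le_trans _ _ (S * (d / (S + 1)))).
    rewrite {1}(mulrC _ _ : S = mxnorm P * mxnorm Q) -mulrA ler_wpM2l ?mxnorm_ge0//.
    apply: le_trans (mxnormM _ _) _; rewrite ler_wpM2l ?mxnorm_ge0//.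
  by rewrite mulrCA ler_piMr ?(ltW d0)// ler_pdivrMr// mul1r lerDl.
have wB : mxnorm w <= B + 1.
  have -> : w = v - (v - w) by rewrite subKr.
  by apply: le_trans (mxnormD _ _) _; rewrite mxnormN -/B lerD2l; exact: le_trans d1.
have Fsub := fd_star_subalg (Ffd k).
have FkP : mx_in (F k) P by exact: mx_in_sub (AF_mono k0k) FP.
have FkQ : mx_in (F k) Q by exact: mx_in_sub (AF_mono k0k) FQ.
have bound (x : R) : x <= d * (mxnorm v + mxnorm w) -> x <= 2^-1.
  move=> h; apply: le_trans h _; rewrite -dB ler_wpM2l ?(ltW d0)//.
  by rewrite -/B mulr2n mulrDl mul1r; lra.
have [] := near_partial_isometry (P := P) (Q := Q) (w := w) Fsub (fd_closed (Ffd k)) => //.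
- by apply: mx_inM => //; exact: mx_inM.
- by rewrite -mulmxA Pi.
- by rewrite !mulmxA Qi.
- apply: bound; rewrite -{1}v1; apply: le_trans (adj_mul_dist _ _) _.
  by rewrite ler_wpM2r// addr_ge0 ?mxnorm_ge0.
- apply: bound; rewrite -{1}v2; have := adj_mul_dist (adjmx v) (adjmx w).
  rewrite !adjmxK -adjmxB !mxnorm_adj => h; apply: le_trans h _.
  by rewrite ler_wpM2r// addr_ge0 ?mxnorm_ge0.
by move=> u [Fu u1 u2]; exists k, u.
Qed.

Lemma AF_cancel (x y z : mvn_monoid A) : x + z = y + z -> x = y.
Proof.
move: x y z; elim/(@mvn_monoid_ind R A) => P; elim/(@mvn_monoid_ind R A) => Q.
elim/(@mvn_monoid_ind R A) => N.
have [k1 [N' [_ FN' ->]]] := AF_projection N 0.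
have [k2 [Q' [k12 FQ' ->]]] := AF_projection Q k1.
have [k3 [P' [k23 FP' ->]]] := AF_projection P k2.
rewrite [LHS]mvn_addE [RHS]mvn_addE => /mxmvn_classP PQ.
have Fk3 := fd_star_subalg (Ffd k3).
have FkN : mx_in (F k3) N' by exact: mx_in_sub (AF_mono (leq_trans k12 k23)) FN'.
have FkQ : mx_in (F k3) Q' by exact: mx_in_sub (AF_mono k23) FQ'.
have FD (S : mxprojection A) : mx_in (F k3) S -> mx_in (F k3) (dsum S N').
  move=> FS' i j; rewrite !mxE; case: (fintype.split i) => a; rewrite !mxE;
  by case: (fintype.split j) => b; rewrite ?mxE//; exact: subalg0.
have [k [v [k3k Fv v1 v2]]] := AF_isometry (FD _ FP') (FD _ FkQ) PQ.
have h := AF_mono k3k.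
by apply: (fd_cancel (Ffd k) _ _ _ Fv v1 v2); apply: mx_in_sub h _.
Qed.

End AFCancellation.

(** * Piecewise linear functions on the unit interval *)

Section PiecewiseLinear.
Context {R : realType}.
Implicit Types (f g : I01 R -> R) (t s : I01 R) (x y z : R).

Lemma I01_bounds t : 0 <= \val t <= 1.
Proof. by have := valP t; rewrite inE /= in_itv. Qed.

Lemma I01_ge0 t : 0 <= \val t. Proof. by case/andP: (I01_bounds t). Qed.
Lemma I01_le1 t : \val t <= 1. Proof. by case/andP: (I01_bounds t). Qed.

Lemma pt_subproof x : Num.min 1 (Num.max 0 x) \in (`[0, 1]%classic : set R).
Proof. by rewrite inE /= in_itv /= le_min ge_min ler01 le_max !lexx. Qed.

Definition pt x : I01 R := exist _ (Num.min 1 (Num.max 0 x)) (pt_subproof x).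

Lemma val_pt x : 0 <= x -> x <= 1 -> \val (pt x) = x.
Proof. by move=> x0 x1; rewrite /= max_r// min_r. Qed.

Lemma pt_val t : pt (\val t) = t.
Proof. by apply: val_inj; rewrite val_pt ?I01_ge0 ?I01_le1. Qed.

Definition lin_on f x y (a b : int) : Prop :=
  forall t, x <= \val t <= y -> f t = a%:~R * \val t + b%:~R.

Inductive pl f : R -> R -> Prop :=
| pl_lin x y a b : x <= y -> lin_on f x y a b -> pl f x y
| pl_cat x z y : pl f x z -> pl f z y -> pl f x y.

Lemma pl_le f x y : pl f x y -> x <= y.
Proof. by elim=> // x' z y' _ h1 _; exact: le_trans. Qed.

Lemma M1_pl f : M1 R f -> pl f 0 1.
Proof.
move=> [_ [s hs]]; suff h n x y : 0 <= x -> x <= y -> y <= 1 ->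
    (count (fun u => x < u < y)%R s <= n)%N -> pl f x y.
  exact: (h (count (fun u => 0 < u < 1) s)).
elim: n x y => [|n IH] x y x0 xy y1 hn.
  have [|a [b hab]] := hs x y x0 xy y1; last exact: pl_lin hab.
  move=> u us; apply/negP => hu; move: hn; rewrite leqn0 -leqn0 leqNgt.
  by rewrite -has_count => /negP; apply; apply/hasP; exists u.
have [/hasP[z zs /andP[xz zy]]|/hasPn hh] := boolP (has (fun u => x < u < y) s); last first.
  by have [a [b hab]] := hs x y x0 xy y1 hh; exact: pl_lin hab.
have lt (x' y' : R) : x <= x' -> y' <= y -> ~~ (x' < z < y') ->
    (count (fun u => x' < u < y')%R s < n.+1)%N.
  move=> xx' yy' hz; apply: leq_trans hn.
  have -> : count (fun u => x < u < y) s =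
      (count (fun u => x' < u < y')%R s + count (fun u => (x < u < y) && ~~
        (x' < u < y'))%R s)%N.
    rewrite -count_predUI [X in (_ + X)%N](_ : _ = 0%N) ?addn0; last first.
      by apply/eqP; rewrite -leqn0 leqNgt -has_count; apply/negP => /hasP[u _ /=]; case:
        (x' < u < y'); rewrite ?andbF.
    apply: eq_count => u /=; case: (boolP (x' < u < y')) => [/andP[h1 h2]|_]; last by
      rewrite andbT.
    by rewrite (le_lt_trans xx' h1) (lt_le_trans h2 yy').
  rewrite -[ltnLHS]addn0 ltn_add2l -has_count; apply/hasP; exists z => //=.
  by rewrite xz zy.
apply: (@pl_cat _ _ z).
  apply: IH => //; [exact: ltW|exact/ltW/(lt_le_trans zy)|].
  by rewrite -ltnS lt// ?(ltW zy)// ltxx andbF.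
apply: IH => //; [exact/ltW/(le_lt_trans x0)|exact: ltW|].
by rewrite -ltnS lt// ?(ltW xz)// ltxx.
Qed.

Lemma pl_breaks f x y : pl f x y -> exists s : seq R, forall u v : R,
    x <= u -> u <= v -> v <= y -> (forall w, w \in s -> ~~ (u < w < v)) ->
    exists a b, lin_on f u v a b.
Proof.
elim=> [{}x {}y a b _ hab|{}x z {}y xz [s hs] zy [t ht]].
  exists [::] => u v xu uv vy _; exists a, b => w /andP[uw wv].
  by apply: hab; rewrite (le_trans xu uw) (le_trans wv vy).
exists (s ++ z :: t) => u v xu uv vy hw.
have [vz|zv] := leP v z.
  by apply: hs => // w ws; apply: hw; rewrite mem_cat ws.
apply: ht => //; last by move=> w wt; apply: hw; rewrite mem_cat inE wt !orbT.
rewrite leNgt; apply/negP => uz; have := hw z _.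
by rewrite mem_cat inE eqxx orbT uz zv => /(_ isT).
Qed.

Lemma pl_M1 f : continuous f -> pl f 0 1 -> M1 R f.
Proof. by move=> fc /pl_breaks[s hs]; split=> //; exists s. Qed.

Lemma pl_min1 f x y : pl f x y -> pl (fun t => Num.min (f t) 1) x y.
Proof.
elim=> [{}x {}y a b xy hab|{}x z {}y _ xz _ zy]; last exact: pl_cat xz zy.
pose l (u : R) : R := a%:~R * u + b%:~R.
have below u v : x <= u -> u <= v -> v <= y -> l u <= 1 -> l v <= 1 ->
    pl (fun t => Num.min (f t) 1) u v.
  move=> xu uv vy lu lv; apply: (@pl_lin _ _ _ a b uv) => t /andP[ut tv].
  rewrite hab ?(le_trans xu) ?(le_trans tv)// min_l//.
  rewrite -/(l _); have [a0|a0] := leP 0 (a%:~R : R).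
    apply: le_trans lv; rewrite lerD2r ler_wpM2l//.
  by apply: le_trans lu; rewrite lerD2r ler_wnM2l// ltW.
have above u v : x <= u -> u <= v -> v <= y -> 1 <= l u -> 1 <= l v ->
    pl (fun t => Num.min (f t) 1) u v.
  move=> xu uv vy lu lv; apply: (@pl_lin _ _ _ 0 1 uv) => t /andP[ut tv].
  rewrite hab ?(le_trans xu) ?(le_trans tv)// mul0r add0r min_r//.
  rewrite -/(l _); have [a0|a0] := leP 0 (a%:~R : R).
    by apply: le_trans lu _; rewrite lerD2r ler_wpM2l.
  by apply: le_trans lv _; rewrite lerD2r ler_wnM2l// ltW.
pose z : R := (1 - b%:~R) / a%:~R.
have lz : a != 0 -> l z = 1.
  by move=> a0; rewrite /l /z mulrC divfK ?intr_eq0// subrK.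
have [lx|lx] := leP (l x) 1; have [ly|ly] := leP (l y) 1.
- exact: below.
- have ap : 0 < (a%:~R : R).
    by rewrite ltNge; apply/negP => an; move: lx ly; rewrite /l; nra.
  have {}lz : l z = 1 by apply: lz; rewrite -(intr_eq0 R) gt_eqF.
  have xz : x <= z by rewrite -(ler_pM2l ap) -(lerD2r b%:~R) -!/(l _) lz.
  have zy : z <= y by rewrite -(ler_pM2l ap) -(lerD2r b%:~R) -!/(l _) lz ltW.
  by apply: (@pl_cat _ _ z); [apply: below|apply: above]; rewrite ?lz// ltW.
- have ap : (a%:~R : R) < 0.
    by rewrite ltNge; apply/negP => an; move: lx ly; rewrite /l; nra.
  have {}lz : l z = 1 by apply: lz; rewrite -(intr_eq0 R) lt_eqF.
  have xz : x <= z by rewrite -(ler_nM2l ap) -(lerD2r b%:~R) -!/(l _) lz ltW.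
  have zy : z <= y by rewrite -(ler_nM2l ap) -(lerD2r b%:~R) -!/(l _) lz.
  by apply: (@pl_cat _ _ z); [apply: above|apply: below]; rewrite ?lz// ltW.
- by apply: above => //; exact: ltW.
Qed.

Lemma M1_min1 f : M1 R f -> M1 R (fun t => Num.min (f t) 1).
Proof.
move=> fM; apply: pl_M1; last exact/pl_min1/M1_pl.
have [fc _] := fM; move=> t.
apply: continuous_min; [exact: fc|exact: cst_continuous].
Qed.

Lemma pl_flip f x y : pl f x y -> pl (fun t => f (pt (1 - \val t))) (1 - y) (1 - x).
Proof.
elim=> [{}x {}y a b xy hab|{}x z {}y _ xz _ zy]; last exact: pl_cat zy xz.
apply: (@pl_lin _ _ _ (- a) (a + b)); first by rewrite lerD2l lerN2.
move=> t /andP[yt tx]; have t0 := I01_ge0 t; have t1 := I01_le1 t.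
have vE : \val (pt (1 - \val t)) = 1 - \val t by apply: val_pt; lra.
rewrite hab vE; last by apply/andP; split; lra.
by rewrite rmorphN rmorphD /=; ring.
Qed.

Lemma val_continuous : continuous (fun t : I01 R => \val t : R).
Proof. exact: initial_continuous. Qed.

Lemma flip_continuous : continuous (fun t : I01 R => pt (1 - \val t)).
Proof.
apply: continuous_comp_initial => t /=.
rewrite (_ : _ \o _ = fun t : I01 R => 1 - \val t); last first.
  apply/funext => u /=; rewrite [LHS]val_pt//.
    by rewrite subr_ge0 I01_le1.
  by rewrite gerBl I01_ge0.
apply: continuousB; [exact: cst_continuous|exact: val_continuous].
Qed.

Lemma M1_flip f : M1 R f -> M1 R (fun t => f (pt (1 - \val t))).
Proof.
move=> fM; apply: pl_M1.
  have [fc _] := fM => t.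
  by apply: (@continuous_comp _ _ _ (fun t => pt (1 - \val t)) f);
    [exact: flip_continuous|exact: fc].
by have := pl_flip (M1_pl fM); rewrite subrr subr0.
Qed.

Lemma M1_id : M1 R (fun t => \val t).
Proof.
apply: pl_M1; first exact: val_continuous.
by apply: (@pl_lin _ _ _ 1 0) => // t _; rewrite mul1r addr0.
Qed.

Lemma pl_ivt f x y v : pl f x y -> 0 <= x -> y <= 1 ->
  f (pt x) <= v <= f (pt y) \/ f (pt y) <= v <= f (pt x) ->
  exists2 z, x <= z <= y & f (pt z) = v.
Proof.
move=> h; elim: h v => [{}x {}y a b xy hab|{}x z {}y xz IH1 zy IH2] v x0 y1 hv.
  have ptE u : x <= u <= y -> f (pt u) = a%:~R * u + b%:~R.
    move=> /andP[xu uy].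
    have uE : \val (pt u) = u by rewrite val_pt ?(le_trans x0)// (le_trans uy).
    by rewrite hab uE // xu uy.
  rewrite !ptE ?lexx ?xy// in hv.
  have [a0|a0] := eqVneq a 0.
    exists x; rewrite ?lexx// ptE ?lexx//.
    by move: hv; rewrite a0 !mul0r !add0r => -[] /le_anti.
  pose z : R := (v - b%:~R) / a%:~R.
  have az : a%:~R * z = v - b%:~R by rewrite mulrC divfK// intr_eq0.
  have zxy : x <= z <= y.
    have : (a%:~R : R) != 0 by rewrite intr_eq0.
    case: (ltgtP (a%:~R : R) 0) => // [an|ap] _.
      have h1 : x <= z by rewrite leNgt; apply/negP => zx; case: hv => /andP[]; nra.
      have h2 : z <= y by rewrite leNgt; apply/negP => zx; case: hv => /andP[]; nra.
      by rewrite h1 h2.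
    have h1 : x <= z by rewrite leNgt; apply/negP => zx; case: hv => /andP[]; nra.
    have h2 : z <= y by rewrite leNgt; apply/negP => zx; case: hv => /andP[]; nra.
    by rewrite h1 h2.
  by exists z => //; rewrite ptE// az subrK.
have xz' := pl_le xz; have zy' := pl_le zy.
have [u|u] : (f (pt x) <= v <= f (pt z) \/ f (pt z) <= v <= f (pt x)) \/
  (f (pt z) <= v <= f (pt y) \/ f (pt y) <= v <= f (pt z)).
  case: hv => /andP[h1 h2]; have [h|/ltW h] := leP v (f (pt z)).
  - by left; left; rewrite h1.
  - by right; left; rewrite h h2.
  - by right; right; rewrite h1.
  - by left; right; rewrite h h2.
- have [w /andP[xw wz] hw] := IH1 v x0 (le_trans zy' y1) u.
  by exists w => //; rewrite xw (le_trans wz).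
- have [w /andP[xw wz] hw] := IH2 v (le_trans x0 xz') y1 u.
  by exists w => //; rewrite wz (le_trans xz').
Qed.

Lemma pl_slope f x y : injective f -> pl f x y -> 0 <= x -> y <= 1 ->
  (forall u v, x <= u -> u <= v -> v <= y -> v - u <= f (pt v) - f (pt u)) \/
  (forall u v, x <= u -> u <= v -> v <= y -> v - u <= f (pt u) - f (pt v)).
Proof.
move=> finj; elim=> [{}x {}y a b xy hab|{}x z {}y xz IH1 zy IH2] x0 y1.
  have ptE u : x <= u <= y -> f (pt u) = a%:~R * u + b%:~R.
    move=> /andP[xu uy].
    have uE : \val (pt u) = u by rewrite val_pt ?(le_trans x0)// (le_trans uy).
    by rewrite hab uE // xu uy.
  have [a0|a0|a0] := ltgtP a 0.
  - right=> u v xu uv vy; rewrite !ptE ?xu ?vy ?(le_trans xu)// ?(le_trans uv)//.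
    have : (a%:~R : R) <= (-1)%:~R by rewrite ler_int; lia.
    rewrite rmorphN1.
    by nra.
  - left=> u v xu uv vy; rewrite !ptE ?xu ?vy ?(le_trans xu)// ?(le_trans uv)//.
    have : (1 : R) <= a%:~R by rewrite (ler_int R 1).
    by nra.
  left=> u v xu uv vy.
  have : f (pt x) = f (pt y) by rewrite !ptE ?lexx ?xy// a0 !mul0r.
  move=> /finj /(congr1 val); rewrite !val_pt ?(le_trans x0)// ?(le_trans xy)// => xyE.
  have -> : u = v by apply/le_anti; rewrite uv (le_trans vy)// -xyE.
  by rewrite !subrr.
have xz' := pl_le xz; have zy' := pl_le zy.
have z0 := le_trans x0 xz'; have z1 := le_trans zy' y1.
have pinj u v : 0 <= u -> u <= 1 -> 0 <= v -> v <= 1 -> f (pt u) = f (pt v) -> u = v.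
  by move=> u0 u1 v0 v1 /finj /(congr1 val); rewrite !val_pt.
have [->|xz0] := eqVneq x z; first exact: IH2.
have [zy0|zy0] := eqVneq z y; first by rewrite -zy0; exact: IH1.
have xlz : x < z by rewrite lt_neqAle xz0.
have zly : z < y by rewrite lt_neqAle zy0.
have nolocal : ~ (f (pt z) < f (pt x) /\ f (pt z) < f (pt y)) /\
               ~ (f (pt x) < f (pt z) /\ f (pt y) < f (pt z)).
  split=> -[h1 h2].
    have [h|/ltW h] := leP (f (pt x)) (f (pt y)).
      have [|w /andP[zw wy] hw] := @pl_ivt f z y (f (pt x)) zy z0 y1.
        by left; rewrite h ltW.
      have := pinj w x; rewrite hw !(le_trans z0 zw, le_trans wy y1, x0, ltW
        (lt_le_trans xlz z1)) => /(_ isT isT isT isT erefl) wx.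
      by move: (lt_le_trans xlz zw); rewrite wx ltxx.
    have [|w /andP[xw wz] hw] := @pl_ivt f x z (f (pt y)) xz x0 z1.
      by right; rewrite h ltW.
    have := pinj w y; rewrite hw !(le_trans x0 xw, le_trans wz z1, y1, ltW
      (le_lt_trans z0 zly)) => /(_ isT isT isT isT erefl) wx.
    by move: (le_lt_trans wz zly); rewrite wx ltxx.
  have [h|/ltW h] := leP (f (pt y)) (f (pt x)).
    have [|w /andP[zw wy] hw] := @pl_ivt f z y (f (pt x)) zy z0 y1.
      by right; rewrite h ltW.
    have := pinj w x; rewrite hw !(le_trans z0 zw, le_trans wy y1, x0, ltW
      (lt_le_trans xlz z1)) => /(_ isT isT isT isT erefl) wx.
    by move: (lt_le_trans xlz zw); rewrite wx ltxx.
  have [|w /andP[xw wz] hw] := @pl_ivt f x z (f (pt y)) xz x0 z1.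
    by left; rewrite h ltW.
  have := pinj w y; rewrite hw !(le_trans x0 xw, le_trans wz z1, y1, ltW (le_lt_trans z0 zly))
    => /(_ isT isT isT isT erefl) wx.
  by move: (le_lt_trans wz zly); rewrite wx ltxx.
have [] := IH1 x0 z1; have [] := IH2 z0 y1 => h2 h1.
- left=> u v xu uv vy; have [vz|zv] := leP v z; first exact: h1.
  have [uz|zu] := leP u z; last by apply: h2 => //; exact: ltW.
  have := h1 u z xu uz (lexx _); have := h2 z v (lexx _) (ltW zv) vy; lra.
- case: nolocal => _ []; have := h1 x z (lexx _) xz' (lexx _); have := h2 z y (lexx _) zy'
  (lexx _).
  by split; lra.
- case: nolocal => + _ => -[]; have := h1 x z (lexx _) xz' (lexx _); have := h2 z y
  (lexx _) zy' (lexx _).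
  by split; lra.
- right=> u v xu uv vy; have [vz|zv] := leP v z; first exact: h1.
  have [uz|zu] := leP u z; last by apply: h2 => //; exact: ltW.
  have := h1 u z xu uz (lexx _); have := h2 z v (lexx _) (ltW zv) vy; lra.
Qed.

Lemma M1_injective f : M1 R f -> injective f -> (forall t, 0 <= f t <= 1) ->
  f = (fun t => \val t) \/ f = (fun t => 1 - \val t).
Proof.
move=> /M1_pl fpl finj f01.
have [h|h] := pl_slope finj fpl (lexx _) (lexx _); [left|right]; apply/funext => t.
all: have := I01_ge0 t; have := I01_le1 t => t1 t0.
all: have := h 0 (\val t) (lexx _) t0 t1; have := h (\val t) 1 t0 t1 (lexx _).
all: rewrite pt_val; have /andP[] := f01 (pt 0); have /andP[] := f01 (pt 1).
all: lra.
Qed.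

End PiecewiseLinear.

(** * The McNaughton theorem in one variable *)

Section McNaughton.
Context {R : realType}.
Implicit Types (f g u w : I01 R -> R) (t s : I01 R) (x y z : R).

Inductive mvgen : (I01 R -> R) -> Prop :=
| mvgen_id : mvgen (fun t => \val t)
| mvgen0 : mvgen (fun=> 0)
| mvgenC f : mvgen f -> mvgen (fun t => 1 - f t)
| mvgenD f g : mvgen f -> mvgen g -> mvgen (fun t => Num.min (f t + g t) 1).

Lemma mvgen_bounds f t : mvgen f -> 0 <= f t <= 1.
Proof.
elim=> [||g _ /andP[g0 g1]|g h _ /andP[g0 g1] _ /andP[h0 h1]].
- exact: I01_bounds.
- by rewrite lexx ler01.
- by rewrite subr_ge0 g1 gerBl.
- by rewrite le_min ler01 addr_ge0//= ge_min lexx orbT.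
Qed.

Definition lipschitz f (L : R) := forall s t, `|f s - f t| <= L * `|\val s - \val t|.

Lemma min1_dist (a b : R) : `|Num.min a 1 - Num.min b 1| <= `|a - b|.
Proof.
have [a1|a1] := leP a 1; have [b1|b1] := leP b 1 => //; rewrite ?subrr ?normr0//.
- by rewrite !ler0_norm ?subr_le0//; lra.
- by rewrite !ger0_norm ?subr_ge0//; lra.
Qed.

Lemma mvgen_lipschitz f : mvgen f -> exists2 L, 0 <= L & lipschitz f L.
Proof.
elim=> [||g _ [L L0 hL]|g h _ [L L0 hL] _ [K K0 hK]].
- by exists 1 => // s t; rewrite mul1r.
- by exists 0 => // s t; rewrite subrr normr0 mul0r.
- exists L => // s t; rewrite (_ : 1 - g s - (1 - g t) = g t - g s); last by ring.
  by rewrite distrC.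
- exists (L + K) => [|s t]; first exact: addr_ge0.
  apply: le_trans (min1_dist _ _) _; rewrite opprD addrACA mulrDl.
  by apply: le_trans (ler_normD _ _) _; exact: lerD.
Qed.

Lemma mvgen_ext f g : mvgen f -> f =1 g -> mvgen g.
Proof. by move=> hf /funext <-. Qed.

Lemma mvgen1 : mvgen (fun=> 1).
Proof. by apply: mvgen_ext (mvgenC mvgen0) _ => t; rewrite subr0. Qed.

Lemma mvgenM f g : mvgen f -> mvgen g -> mvgen (fun t => Num.max (f t + g t - 1) 0).
Proof.
move=> hf hg; apply: mvgen_ext (mvgenC (mvgenD (mvgenC hf) (mvgenC hg))) _ => t /=.
by rewrite minEle maxEle; case: ifP; case: ifP; lra.
Qed.

Lemma mvgenB f g : mvgen f -> mvgen g -> mvgen (fun t => Num.max (f t - g t) 0).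
Proof.
move=> hf hg; apply: mvgen_ext (mvgenM hf (mvgenC hg)) _ => t /=.
by congr (Num.max _ _); ring.
Qed.

Lemma mvgen_max f g : mvgen f -> mvgen g -> mvgen (fun t => Num.max (f t) (g t)).
Proof.
move=> hf hg; apply: mvgen_ext (mvgenD (mvgenB hf hg) hg) _ => t /=.
have /andP[f0 f1] := mvgen_bounds t hf; have /andP[g0 g1] := mvgen_bounds t hg.
by rewrite minEle !maxEle; case: ifP; case: ifP; case: ifP; lra.
Qed.

Definition clip (x : R) : R := Num.max 0 (Num.min 1 x).

Lemma clip_id x : 0 <= x <= 1 -> clip x = x.
Proof. by move=> /andP[x0 x1]; rewrite /clip min_r// max_r. Qed.

Lemma clip_le0 x : x <= 0 -> clip x = 0.
Proof. by move=> x0; rewrite /clip max_l// ge_min x0 orbT. Qed.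

Lemma clip_ge1 x : 1 <= x -> clip x = 1.
Proof. by move=> x1; rewrite /clip min_l// max_r. Qed.

Lemma clipC x : 1 - clip (1 - x) = clip x.
Proof.
have [x0|x0] := leP x 0; first by rewrite clip_ge1 ?clip_le0 ?subrr//; lra.
have [x1|x1] := leP x 1; first by rewrite !clip_id ?subKr//; lra.
by rewrite clip_le0 ?clip_ge1 ?subr0//; lra.
Qed.

Lemma clip_cases x : [\/ x <= 0 /\ clip x = 0, 0 <= x <= 1 /\ clip x = x |
  1 <= x /\ clip x = 1].
Proof.
have [x0|x0] := leP x 0.
  by apply: Or31; rewrite clip_le0.
have [x1|x1] := leP x 1.
  by apply: Or32; rewrite ltW//; split=> //; rewrite clip_id// ltW.
by apply: Or33; rewrite clip_ge1 ?ltW.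
Qed.

(* The identity of Rose and Rosser, which increases the slope of a truncated
   line by one. *)
Lemma rose_rosser (l v : R) : 0 <= v <= 1 ->
  Num.max (Num.min (clip l + v) 1 + clip (l + 1) - 1) 0 = clip (l + v).
Proof.
move=> /andP[v0 v1].
have [l1|l1] := leP l (-1).
  rewrite !clip_le0; [|lra|lra|lra].
  by rewrite add0r addr0 min_l// max_r// subr_le0.
have [l2|l2] := leP l 0.
  rewrite (clip_le0 l2) clip_id; last lra.
  by rewrite add0r min_l// addrA addrK addrC maxC /clip min_r//; lra.
rewrite (clip_ge1 (x := l + 1)) ?addrK; last lra.
have [l3|l3] := leP l 1; first by rewrite clip_id ?(ltW l2)// maxC minC.
rewrite !clip_ge1 ?min_r ?max_l//; lra.
Qed.

Lemma mvgen_clip (a b : int) : mvgen (fun t => clip (a%:~R * \val t + b%:~R)).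
Proof.
have nat_slope (n : nat) (c : int) : mvgen (fun t => clip (n%:R * \val t + c%:~R)).
  elim: n c => [|n IH] c.
    have [c0|c0] := leP c 0.
      apply: mvgen_ext mvgen0 _ => t; rewrite mul0r add0r.
      have : c%:~R <= (0 : R) by rewrite (ler_int R c 0).
      by rewrite /clip minEle maxEle; case: ifP; case: ifP; lra.
    apply: mvgen_ext mvgen1 _ => t; rewrite mul0r add0r.
    have : (1 : R) <= c%:~R by rewrite (ler_int R 1).
    by rewrite /clip minEle maxEle; case: ifP; case: ifP; lra.
  apply: mvgen_ext (mvgenM (mvgenD (IH c) mvgen_id) (IH (c + 1))) _ => t /=.
  transitivity (clip (n%:R * \val t + c%:~R + \val t)).
    rewrite -(rose_rosser _ (I01_bounds t)); congr (Num.max (_ + clip _ - 1) 0).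
    by rewrite rmorphD addrA.
  by rewrite -natr1 mulrDl mul1r addrAC.
case: a => n; first exact: nat_slope.
apply: mvgen_ext (mvgenC (nat_slope n.+1 (1 - b))) _ => t.
rewrite -[RHS]clipC NegzE rmorphN rmorphB /=; congr (1 - clip _).
by rewrite mulNr opprD opprK addrCA.
Qed.

(* [max (u - P) (w - Q)], where [P] vanishes on the left of [z], [Q] on its right,
   and both are steeper than the Lipschitz constants of [u] and [w] elsewhere.
   The point [z] may be irrational as long as [c t + d] vanishes at [z]. *)
Lemma glue u w z (c d : int) : mvgen u -> mvgen w -> 0 <= z -> z <= 1 ->
  u (pt z) = w (pt z) -> 0 < c -> c%:~R * z + d%:~R = 0 ->
  exists g, [/\ mvgen g, forall t, \val t <= z -> g t = u t &
    forall t, z <= \val t -> g t = w t].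
Proof.
move=> hu hw z0 z1 uw c0 cz.
have [L L0 hL] := mvgen_lipschitz hu; have [K K0 hK] := mvgen_lipschitz hw.
have [n hn] : exists n : nat, L + K <= n%:R.
  by exists (Num.trunc (L + K)).+1; apply/ltW/truncnS_gt.
pose P t := clip ((n%:Z * c)%:~R * \val t + (n%:Z * d)%:~R).
pose Q t := clip ((n%:Z * - c)%:~R * \val t + (n%:Z * - d)%:~R).
have hP : mvgen P by exact: mvgen_clip.
have hQ : mvgen Q by exact: mvgen_clip.
have PE t : P t = clip (n%:R * (c%:~R * (\val t - z))).
  congr clip; rewrite !rmorphM /= mulrBr (_ : d%:~R = - (c%:~R * z)); first by ring.
  by apply/eqP; rewrite -addr_eq0 addrC cz.
have QE t : Q t = clip (n%:R * (c%:~R * (z - \val t))).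
  congr clip; rewrite !rmorphM !rmorphN /= mulrBr (_ : d%:~R = - (c%:~R * z)); first by ring.
  by apply/eqP; rewrite -addr_eq0 addrC cz.
have c1 : 1 <= c%:~R :> R by rewrite (ler_int R 1).
have steep x : 0 <= x -> (L + K) * x <= n%:R * (c%:~R * x).
  move=> x0; apply: le_trans (ler_wpM2r x0 hn) _; rewrite ler_wpM2l//.
  by rewrite ler_peMl.
have zv : \val (pt z) = z by exact: val_pt.
exists (fun t => Num.max (Num.max (u t - P t) 0) (Num.max (w t - Q t) 0)); split.
- by apply: mvgen_max; exact: mvgenB.
- move=> t tz; have zt : 0 <= z - \val t by rewrite subr_ge0.
  have := steep _ zt; rewrite PE QE.
  have -> : clip (n%:R * (c%:~R * (\val t - z))) = 0.
    have : n%:R * (c%:~R * (\val t - z)) <= 0.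
      rewrite -oppr_ge0 -!mulrN opprB !mulr_ge0// ?(le_trans ler01)//.
    exact: clip_le0.
  move=> hs; have := hL t (pt z); have := hK t (pt z).
  rewrite zv distrC (distrC (\val t)) (ger0_norm zt) => h1 h2.
  have := ler_norm (u (pt z) - u t); rewrite distrC => h3.
  have := ler_norm (w t - w (pt z)); rewrite distrC => h4.
  have /andP[u0 u1] := mvgen_bounds t hu; have /andP[w0 w1] := mvgen_bounds t hw.
  move: (n%:R * _) hs => q hs.
  have wuq : w t <= u t + q.
    by move: hs; rewrite mulrDl; lra.
  rewrite subr0 (max_l u0) max_l// ge_max u0 andbT.
  by case: (clip_cases q) => -[h ->]; lra.
- move=> t tz; have zt : 0 <= \val t - z by rewrite subr_ge0.
  have := steep _ zt; rewrite PE QE.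
  have -> : clip (n%:R * (c%:~R * (z - \val t))) = 0.
    have : n%:R * (c%:~R * (z - \val t)) <= 0.
      rewrite -oppr_ge0 -!mulrN opprB !mulr_ge0// ?(le_trans ler01)//.
    exact: clip_le0.
  move=> hs; have := hL t (pt z); have := hK t (pt z).
  rewrite zv (ger0_norm zt) => h1 h2.
  have := ler_norm (u t - u (pt z)) => h3.
  have := ler_norm (w (pt z) - w t); rewrite distrC => h4.
  have /andP[u0 u1] := mvgen_bounds t hu; have /andP[w0 w1] := mvgen_bounds t hw.
  move: (n%:R * _) hs => q hs.
  have wuq : u t <= w t + q.
    by move: hs; rewrite mulrDl; lra.
  rewrite subr0 (max_l w0) max_r// ge_max w0 andbT.
  by case: (clip_cases q) => -[h ->]; lra.
Qed.

Definition mv_extends f y : Prop := exists g (a b : int), [/\ mvgen g,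
  forall t, \val t <= y -> g t = f t,
  forall t, y <= \val t -> g t = clip (a%:~R * \val t + b%:~R) &
  f (pt y) = a%:~R * y + b%:~R].

Lemma mv_extends_pl f x y : (forall t, 0 <= f t <= 1) -> pl f x y ->
  0 <= x -> y <= 1 -> mv_extends f x -> mv_extends f y.
Proof.
move=> f01; elim=> [{}x {}y a' b' xy hab|{}x z {}y xz IH1 zy IH2] x0 y1 hx; last first.
  have xz' := pl_le xz; have zy' := pl_le zy.
  by apply: IH2 => //; [exact: le_trans xz'|apply: IH1 => //; exact: le_trans y1].
have [g [a [b [hg gf gl fx]]]] := hx.
have x1 := le_trans xy y1; have y0 := le_trans x0 xy.
have xv : \val (pt x) = x by exact: val_pt.
have yv : \val (pt y) = y by exact: val_pt.
have fx' : f (pt x) = a'%:~R * x + b'%:~R by rewrite hab xv// lexx xy.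
have fy' : f (pt y) = a'%:~R * y + b'%:~R by rewrite hab yv// lexx xy.
have glued : exists g', [/\ mvgen g', forall t, \val t <= x -> g' t = g t &
    forall t, x <= \val t -> g' t = clip (a'%:~R * \val t + b'%:~R)].
  have glx : g (pt x) = clip (a'%:~R * \val (pt x) + b'%:~R).
    by rewrite gf ?xv// -fx' clip_id.
  have ab : (a'%:~R - a%:~R) * x + (b'%:~R - b%:~R) = 0.
    by rewrite mulrBl; move: fx fx' => -> h; rewrite addrACA -opprD -h subrr.
  have [aa|aa|aa] := ltgtP a a'.
  - apply: (@glue g (fun t => clip (a'%:~R * \val t + b'%:~R)) x (a' - a) (b' - b)) => //.
    + exact: mvgen_clip.
    + by rewrite subr_gt0.
    + by rewrite !rmorphB.
  - apply: (@glue g (fun t => clip (a'%:~R * \val t + b'%:~R)) x (a - a') (b - b')) => //.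
    + exact: mvgen_clip.
    + by rewrite subr_gt0.
    + by rewrite !rmorphB /= -[RHS]oppr0 -ab; ring.
  - exists g; split=> // t xt; rewrite gl// -aa; congr (clip (_ + _)).
    by move: ab; rewrite aa subrr mul0r add0r => /eqP; rewrite subr_eq0 => /eqP.
have [g' [hg' g'g g'l]] := glued.
exists g', a', b'; split=> // t ht; last by apply: g'l; exact: le_trans ht.
have [tx|xt] := leP (\val t) x; first by rewrite g'g// gf.
have ft : f t = a'%:~R * \val t + b'%:~R by apply: hab; rewrite (ltW xt) ht.
by rewrite g'l ?(ltW xt)// -ft clip_id.
Qed.

Lemma pl_left f x y : pl f x y -> exists a b : int, forall t, \val t = x
  -> f t = a%:~R * x + b%:~R.
Proof.
elim=> [{}x {}y a b xy hab|//]; exists a, b => t tx.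
by rewrite hab tx// lexx xy.
Qed.

Theorem mcnaughton f : M1 R f -> (forall t, 0 <= f t <= 1) -> mvgen f.
Proof.
move=> /M1_pl fpl f01.
have f0 : mv_extends f 0.
  have [a [b hab]] := pl_left fpl.
  have v0 : \val (pt (0 : R)) = 0 by exact: val_pt.
  have fb : f (pt 0) = b%:~R by rewrite (hab _ v0) mulr0 add0r.
  exists (fun t => clip (0%:~R * \val t + b%:~R)), 0, b; split=> //.
  - exact: mvgen_clip.
  - move=> t t0; have -> : t = pt 0.
      by rewrite -[LHS]pt_val; congr pt; apply/le_anti; rewrite t0 I01_ge0.
    by rewrite mul0r add0r -fb clip_id.
  - by rewrite mul0r add0r.
have [g [a [b [hg gf _ _]]]] := mv_extends_pl f01 fpl (lexx _) (lexx _) f0.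
by apply: mvgen_ext hg _ => t; rewrite gf// I01_le1.
Qed.

End McNaughton.

(** * Coordinates of the Elliott monoid *)

Section Elliott.
Context {R : realType} {A : cstarAlgType R}.
Implicit Types (p q r : projection A) (x y z : elliott A) (m n : mvn_monoid A).

Lemma mvn_classP p q : mvn_class p = mvn_class q <-> mvn_eq p q.
Proof. by split => [/eqquotP/asboolP//|h]; apply/eqquotP/asboolP. Qed.

Lemma elliott_ind (P : elliott A -> Prop) :
  (forall p, P (mvn_class p)) -> forall x, P x.
Proof. by move=> h x; rewrite -(reprK x); exact: h. Qed.

Lemma mxmvn_pmx p q : mxmvn_class (pmx p) = mxmvn_class (pmx q) <-> mvn_eq p q.
Proof.
rewrite mxmvn_classP; split=> -[v [v1 v2]].
  exists (v 0 0); have := congr1 (fun M : 'M[A]_1 => M 0 0) v1.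
  have := congr1 (fun M : 'M[A]_1 => M 0 0) v2.
  by rewrite !mxE !big_ord1 !mxE eqxx !mulr1n => -> ->.
exists v%:M; split; apply: mx11_eq; rewrite !mxE !big_ord1 !mxE !eqxx !mulr1n//.
Qed.

Definition kappa x : mvn_monoid A := mxmvn_class (pmx (repr x)).

Lemma kappaE p : kappa (mvn_class p) = mxmvn_class (pmx p).
Proof. by apply/mxmvn_pmx/mvn_classP; exact: reprK. Qed.

Lemma kappa_inj : injective kappa.
Proof.
apply: elliott_ind => p; apply: elliott_ind => q.
by rewrite !kappaE => /mxmvn_pmx/mvn_classP.
Qed.

Lemma scalar_mx_orth p q : (p : A) * (q : A) = 0 -> ((p : A)%:M : 'M[A]_1) *m (q : A)%:M = 0.
Proof. by move=> pq; apply: mx11_eq; rewrite !mxE big_ord1 !mxE eqxx !mulr1n. Qed.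

Lemma kappa_orth p q r : (p : A) * (q : A) = 0 -> (r : A) = (p : A) + (q : A) ->
  kappa (mvn_class r) = kappa (mvn_class p) + kappa (mvn_class q).
Proof.
move=> pq rE; rewrite !kappaE; apply: mxmvn_class_orth; first exact: scalar_mx_orth.
by apply: mx11_eq; rewrite !mxE eqxx !mulr1n rE.
Qed.

Lemma kappa0 : kappa (elliott0 A) = 0.
Proof.
rewrite kappaE; apply/mxmvn_classP; exists 0.
by rewrite mul0mx mulmx0 /= raddf0.
Qed.

Definition elliott1 : elliott A := mvn_class (prC (pr0 A)).

Lemma kappa1 : kappa elliott1 = mxmvn_class (mxpr11 A).
Proof.
rewrite kappaE; apply/mxmvn_classP; exists 1%:M.
by rewrite adjmx1 mulmx1 /= subr0.
Qed.

Lemma prC_orth p : (p : A) * (prC p : A) = 0.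
Proof. by rewrite /= mulrBr mulr1 pr_idem subrr. Qed.

Lemma kappaC x : kappa x + kappa (elliottC x) = kappa elliott1.
Proof.
rewrite -[in kappa x](reprK x) -(@kappa_orth _ _ (prC (pr0 A)) (prC_orth _))//.
by rewrite /= subr0 addrC subrK.
Qed.

Lemma mvn_split m n q : m + n = mxmvn_class (pmx q) ->
  exists p r, [/\ (p : A) * (r : A) = 0, (q : A) = (p : A) + (r : A),
    mxmvn_class (pmx p) = m & mxmvn_class (pmx r) = n].
Proof.
move: m n; elim/(@mvn_monoid_ind R A) => P; elim/(@mvn_monoid_ind R A) => Q.
rewrite [LHS]mvn_addE => /mxmvn_classP /mxmvn_eq_corner /= [v [v1 v2 vP _]].
pose a := lsubmx v; pose b := rsubmx v.
have vE : v = row_mx a b by rewrite hsubmxK.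
rewrite vE adjmx_row mul_col_row in v1.
have [aa ab ba bb] := eq_block_mx v1.
rewrite vE adjmx_row mul_row_col in v2.
move: vP; rewrite vE mul_row_block !mulmx0 addr0 add0r => /eq_row_mx[aP bQ].
have diagE (c : 'M[A]_1) : (c 0 0)%:M = c.
  by apply: mx11_eq; rewrite mxE eqxx mulr1n.
have corner k (c : 'M[A]_(1, k)) (P' : 'M[A]_k) : adjmx c *m c = P' -> c *m P' = c ->
    cstar ((c *m adjmx c) 0 0) = (c *m adjmx c) 0 0 /\
    (c *m adjmx c) 0 0 * (c *m adjmx c) 0 0 = (c *m adjmx c) 0 0.
  move=> cc cP; have h1 : adjmx (c *m adjmx c) = c *m adjmx c by rewrite adjmxM adjmxK.
  have h2 : (c *m adjmx c) *m (c *m adjmx c) = c *m adjmx c.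
    by rewrite -mulmxA (mulmxA (adjmx c)) cc mulmxA cP.
  split; first by have := congr1 (fun M : 'M[A]_1 => M 0 0) h1; rewrite mxE.
  by have := congr1 (fun M : 'M[A]_1 => M 0 0) h2; rewrite mxE big_ord1.
have [p1 p2] := corner _ a _ aa aP; have [r1 r2] := corner _ b _ bb bQ.
exists (Projection p1 p2), (Projection r1 r2); split=> /=.
- have h : (a *m adjmx a) *m (b *m adjmx b) = 0.
    by rewrite -mulmxA (mulmxA (adjmx a)) ab mul0mx mulmx0.
  by have := congr1 (fun M : 'M[A]_1 => M 0 0) h; rewrite mxE big_ord1 => ->; rewrite mxE.
- have := congr1 (fun M : 'M[A]_1 => M 0 0) v2; rewrite !mxE eqxx mulr1n => <-.
  by [].
- by apply/esym/mxmvn_classP; exists a; rewrite aa /= diagE.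
- by apply/esym/mxmvn_classP; exists b; rewrite bb /= diagE.
Qed.

Lemma elliott_leP x y : elliott_le x y <-> exists m, kappa x + m = kappa y.
Proof.
split=> [[p [q [<- <- qp]]]|[m]].
  have pq : (p : A) * (q : A) = (p : A) by rewrite -[in LHS](pr_star p) -(pr_star q)
    -cstarM qp pr_star.
  have dS : cstar ((q : A) - (p : A)) = (q : A) - (p : A) by rewrite cstarB !pr_star.
  have dI : ((q : A) - (p : A)) * ((q : A) - (p : A)) = (q : A) - (p : A).
    by rewrite mulrBl !mulrBr !pr_idem qp pq subrr subr0.
  exists (kappa (mvn_class (Projection dS dI))); apply/esym/kappa_orth => /=.
    by rewrite mulrBr pq pr_idem subrr.
  by rewrite addrC subrK.
move=> /(mvn_split (q := repr y))[p [r [pr qE px _]]].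
exists p, (repr y); split; last 1 first.
- by rewrite qE mulrDl pr_idem -(pr_star p) -(pr_star r) -cstarM pr cstar0 addr0 pr_star.
- by apply: kappa_inj; rewrite kappaE.
- exact: reprK.
Qed.

Lemma elliott_orth x y m : kappa x + kappa y + m = kappa elliott1 ->
  exists p q r, [/\ (p : A) * (q : A) = 0, (r : A) = (p : A) + (q : A), mvn_class p = x &
    mvn_class q = y].
Proof.
rewrite kappaE => /mvn_split[r [r' [_ _ hr _]]].
have [p [q [pq rE px qy]]] := mvn_split (esym hr).
by exists p, q, r; split=> //; apply: kappa_inj; rewrite kappaE.
Qed.

Lemma fctD (f g : I01 R -> R) t : (f + g) t = f t + g t. Proof. by []. Qed.

Lemma fctB (f g : I01 R -> R) t : (f - g) t = f t - g t. Proof. by []. Qed.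

Section Coordinates.
Hypothesis cancel : forall m n k : mvn_monoid A, m + k = n + k -> m = n.
Context {phi : K0 A -> (I01 R -> R)}.
Hypotheses (phiD : {morph phi : a b / a + b}) (phi_inj : injective phi).
Hypotheses (phi_range : range phi = M1 R).
Hypothesis phi_pos : forall a, K0_pos a <-> forall t, 0 <= phi a t.
Hypothesis phi1 : phi (K0_unit A) = cst 1.

Definition Phi m : I01 R -> R := phi (groth_pair m 0).

Lemma PhiD m n : Phi (m + n) = Phi m + Phi n.
Proof. by rewrite /Phi -phiD; congr phi; rewrite [RHS]groth_addE addr0. Qed.

Lemma Phi_inj : injective Phi.
Proof. by move=> m n /phi_inj/groth_pairP[r]; rewrite !addr0; exact: cancel. Qed.

Lemma Phi_ge0 m t : 0 <= Phi m t.
Proof.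
move: t; apply/phi_pos; move: m; elim/(@mvn_monoid_ind R A) => P.
by exists P.
Qed.

Lemma Phi_surj f : M1 R f -> (forall t, 0 <= f t) -> exists m, Phi m = f.
Proof.
rewrite -phi_range => -[x _ <-] /phi_pos[P _ <-].
by exists (mxmvn_class P).
Qed.

Definition ecoord x : I01 R -> R := Phi (kappa x).

Lemma ecoord_inj : injective ecoord.
Proof. by move=> x y /Phi_inj/kappa_inj. Qed.

Lemma ecoord1 t : ecoord elliott1 t = 1.
Proof. by rewrite /ecoord kappa1 /Phi -/(K0_class _) -/(K0_unit A) phi1. Qed.

Lemma ecoord0 t : ecoord (elliott0 A) t = 0.
Proof.
have h := PhiD 0 0; rewrite addr0 in h; have := congr1 (fun f => f t) h.
rewrite /ecoord kappa0 => /eqP; rewrite -subr_eq0.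
by rewrite fctD opprD addrA subrr add0r oppr_eq0 => /eqP.
Qed.

Lemma ecoordC x t : ecoord (elliottC x) t = 1 - ecoord x t.
Proof.
rewrite -(ecoord1 t) /ecoord -(kappaC x) PhiD.
by rewrite fctD addrC addKr.
Qed.

Lemma ecoord_ge0 x t : 0 <= ecoord x t. Proof. exact: Phi_ge0. Qed.

Lemma ecoord_le1 x t : ecoord x t <= 1.
Proof. by rewrite -subr_ge0 -ecoordC ecoord_ge0. Qed.

Lemma ecoord_M1 x : M1 R (ecoord x).
Proof. by rewrite -phi_range; exists (groth_pair (kappa x) 0). Qed.

Lemma M1D f g : M1 R f -> M1 R g -> M1 R (f + g).
Proof. by rewrite -phi_range => -[x _ <-] [y _ <-]; exists (x + y). Qed.

Lemma M1B f g : M1 R f -> M1 R g -> M1 R (f - g).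
Proof.
rewrite -phi_range => -[a _ <-] [b _ <-]; exists (a - b) => //.
by apply/eqP; rewrite eq_sym subr_eq -phiD subrK.
Qed.

Lemma M1_cst1 : M1 R (cst 1).
Proof. by rewrite -phi1 -phi_range; exists (K0_unit A). Qed.

Lemma ecoord_surj f : M1 R f -> (forall t, 0 <= f t <= 1) -> exists x, ecoord x = f.
Proof.
move=> fM f01; have [|m hm] := Phi_surj fM; first by move=> t; case/andP: (f01 t).
have [|n hn] := Phi_surj (M1B M1_cst1 fM).
  move=> t; rewrite fctB subr_ge0; by case/andP: (f01 t).
have mn : m + n = kappa elliott1.
  apply: Phi_inj; apply/funext => t; rewrite PhiD hm hn [RHS]ecoord1.
  by rewrite fctD fctB addrC subrK.
rewrite kappaE in mn; have [p [r [_ _ hp _]]] := mvn_split mn.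
by exists (mvn_class p); rewrite /ecoord kappaE hp hm.
Qed.

Lemma ecoord_le x y : elliott_le x y <-> forall t, ecoord x t <= ecoord y t.
Proof.
rewrite elliott_leP; split=> [[m hm] t|h].
  by rewrite /ecoord -hm PhiD fctD lerDl Phi_ge0.
have [|m hm] := Phi_surj (M1B (ecoord_M1 y) (ecoord_M1 x)).
  by move=> t; rewrite fctB subr_ge0.
exists m; apply: Phi_inj; rewrite PhiD hm; apply/funext => t.
by rewrite fctD fctB addrC subrK.
Qed.

Lemma ecoord_orth p q r : (p : A) * (q : A) = 0 -> (r : A) = (p : A) + (q : A) ->
  forall t, ecoord (mvn_class r) t = ecoord (mvn_class p) t + ecoord (mvn_class q) t.
Proof. by move=> pq rE t; rewrite /ecoord (kappa_orth pq rE) PhiD. Qed.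

Lemma ecoord_orth_repr x y : (forall t, ecoord x t + ecoord y t <= 1) ->
  exists p q r, [/\ (p : A) * (q : A) = 0, (r : A) = (p : A) + (q : A), mvn_class p = x &
    mvn_class q = y].
Proof.
move=> h; have [|m hm] := Phi_surj (M1B M1_cst1 (M1D (ecoord_M1 x) (ecoord_M1 y))).
  by move=> t; rewrite fctB fctD subr_ge0.
apply: (elliott_orth (m := m)); apply: Phi_inj; apply/funext => t.
rewrite !PhiD hm [RHS]ecoord1.
by rewrite fctD fctB addrC subrK.
Qed.

Lemma eq_ecoord x y : (forall t, ecoord x t = ecoord y t) -> x = y.
Proof. by move=> h; apply/ecoord_inj/funext. Qed.

Lemma mvn_class_prC p : mvn_class (prC p) = elliottC (mvn_class p).
Proof.
apply: eq_ecoord => t; rewrite ecoordC -(ecoord1 t).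
rewrite (ecoord_orth (prC_orth p) (r := prC (pr0 A))); first by rewrite addrC addKr.
by rewrite /= subr0 addrC subrK.
Qed.

Lemma truncated_sum_exists x y :
  exists z, forall t, ecoord z t = Num.min (ecoord x t + ecoord y t) 1.
Proof.
have [|z hz] := ecoord_surj (M1_min1 (M1D (ecoord_M1 x) (ecoord_M1 y))).
  move=> t; rewrite le_min ler01 ge_min lexx orbT !andbT.
  exact: addr_ge0 (ecoord_ge0 _ _) (ecoord_ge0 _ _).
by exists z => t; rewrite hz.
Qed.

Lemma elliott_sum_exists : exists op, is_elliott_sum (A := A) op.
Proof.
have h (xy : elliott A * elliott A) := truncated_sum_exists xy.1 xy.2.
have [f hf] := choice h; pose op x y := f (x, y).
have opE x y t : ecoord (op x y) t = Num.min (ecoord x t + ecoord y t) 1 by exact: hf.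
exists op; split.
- move=> x y z; apply: eq_ecoord => t; rewrite !opE.
  have := ecoord_ge0 x t; have := ecoord_ge0 y t; have := ecoord_ge0 z t.
  by rewrite !minEle; do ![case: ifP]; lra.
- by move=> x y; apply: eq_ecoord => t; rewrite !opE addrC.
- move=> x y z /ecoord_le xy; apply/ecoord_le => t; rewrite !opE.
  by rewrite le_min !ge_min lexx orbT andbT lerD2r xy.
- move=> p q r pq rE; apply: eq_ecoord => t; rewrite opE -(ecoord_orth pq rE).
  by rewrite min_l// ecoord_le1.
- move=> p; split.
    apply: eq_ecoord => t; rewrite opE -(ecoord_orth (prC_orth p) (r := prC (pr0 A))).
      by rewrite min_l// ecoord_le1.
    by rewrite /= subr0 addrC subrK.
  move=> y hy; apply/ecoord_le => t.
  rewrite mvn_class_prC ecoordC.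
  have := congr1 (fun z => ecoord z t) hy; rewrite opE ecoord1.
  by rewrite minEle; case: ifP; lra.
Qed.

(* With [z = op x y >= y], the sum of [y] and [~z] is Elliott's partial sum,
   and residuation of [op x (y + ~z) = op z (~z) = 1] gives [z <= x + y]. *)
Lemma ecoordD x y t : ecoord (elliottD x y) t = Num.min (ecoord x t + ecoord y t) 1.
Proof.
have : is_elliott_sum (@elliottD R A).
  by have [op hop] := elliott_sum_exists; exact: (xgetPex _ (ex_intro _ op hop)).
move: (@elliottD R A) => op [opA opC ople oporth op1].
have opE u v : (forall s, ecoord u s + ecoord v s <= 1) ->
    forall s, ecoord (op u v) s = ecoord u s + ecoord v s.
  move=> uv s; have [p [q [r [pq rE <- <-]]]] := ecoord_orth_repr uv.
  by rewrite (oporth _ _ _ pq rE); exact: ecoord_orth.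
have resid u v : op u v = elliott1 -> forall s, 1 - ecoord u s <= ecoord v s.
  move: u; apply: elliott_ind => p hv s; rewrite -ecoordC -mvn_class_prC.
  by move: s; apply/ecoord_le; exact: (op1 p).2.
have opC1 u : op u (elliottC u) = elliott1.
  by move: u; apply: elliott_ind => p; rewrite -mvn_class_prC; exact: (op1 p).1.
have mono u v w : (forall s, ecoord u s <= ecoord v s) ->
    forall s, ecoord (op u w) s <= ecoord (op v w) s.
  by move=> /ecoord_le h; apply/ecoord_le; exact: ople.
have [w hw] : exists w, forall s, ecoord w s = Num.min (ecoord y s) (1 - ecoord x s).
  have [v hv] := truncated_sum_exists x y.
  have [|w hw] := ecoord_surj (M1B (ecoord_M1 v) (ecoord_M1 x)).
    move=> s; rewrite fctB hv.
    have := ecoord_ge0 x s; have := ecoord_ge0 y s; have := ecoord_le1 x s.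
    by rewrite minEle; case: ifP; lra.
  exists w => s; rewrite hw fctB hv.
  by rewrite !minEle; do ![case: ifP]; lra.
have lower s : Num.min (ecoord x s + ecoord y s) 1 <= ecoord (op x y) s.
  have := mono w y x _ s; rewrite !(opC _ x) => h.
  apply: le_trans (h _) => [|u]; last by rewrite hw ge_min lexx.
  rewrite opE => [|u]; first by rewrite hw !minEle; do ![case: ifP]; lra.
  by rewrite hw; have := lexx (ecoord x u); rewrite minEle; case: ifP; lra.
apply/le_anti; rewrite lower andbT le_min ecoord_le1 andbT.
pose z := op x y; have zy s : ecoord y s <= ecoord z s.
  have h0 : forall u, ecoord (elliott0 A) u + ecoord y u <= 1.
    by move=> u; rewrite ecoord0 add0r ecoord_le1.
  have := mono (elliott0 A) x y _ s; rewrite (opE _ _ h0) ecoord0 add0r; apply.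
  by move=> u; rewrite ecoord0 ecoord_ge0.
have yz s : ecoord y s + ecoord (elliottC z) s <= 1 by rewrite ecoordC; have := zy s; lra.
have := resid x (op y (elliottC z)); rewrite opA opC1 => /(_ erefl t).
by rewrite opE// ecoordC -/z; lra.
Qed.

End Coordinates.
End Elliott.

(** * Generators and automorphisms *)

Section Generators.
Context {R : realType} {A : cstarAlgType R} {F : elliott A -> (I01 R -> R)}.
Implicit Types (p q : projection A) (x y g : elliott A).
Hypotheses (F_inj : injective F).
Hypotheses (F_M1 : forall x, M1 R (F x)) (F_bounds : forall x t, 0 <= F x t <= 1).
Hypothesis F_surj : forall f, M1 R f -> (forall t, 0 <= f t <= 1) -> exists x, F x = f.
Hypotheses (F0 : forall t, F (elliott0 A) t = 0)
  (FC : forall x t, F (elliottC x) t = 1 - F x t)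
  (FD : forall x y t, F (elliottD x y) t = Num.min (F x t + F y t) 1).

Lemma F_ext x y : (forall t, F x t = F y t) -> x = y.
Proof. by move=> h; apply/F_inj/funext. Qed.

Lemma elliottCK x : elliottC (elliottC x) = x.
Proof. by apply: F_ext => t; rewrite !FC subKr. Qed.

Lemma mvgen_closed (S : set (elliott A)) g f : elliott_closed S -> S g ->
  F g = (fun t => \val t) -> mvgen f -> exists2 x, S x & F x = f.
Proof.
move=> [S0 SC SD] Sg hg; elim=> [||_ _ [x Sx <-]|_ _ _ [x Sx <-] _ [y Sy <-]].
- by exists g.
- by exists (elliott0 A) => //; apply/funext => t; rewrite F0.
- by exists (elliottC x); [exact: SC|apply/funext => t; rewrite FC].
- by exists (elliottD x y); [exact: SD|apply/funext => t; rewrite FD].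
Qed.

Lemma generator_id g : F g = (fun t => \val t) -> elliott_generator g.
Proof.
move=> hg S Scl Sg; apply/seteqP; split=> // x _.
have [y Sy yx] := mvgen_closed Scl Sg hg (mcnaughton (F_M1 x) (F_bounds x)).
by rewrite -(F_inj yx).
Qed.

Lemma generatorC g : elliott_generator g -> elliott_generator (elliottC g).
Proof.
move=> hg S Scl Sg; apply: hg => //; rewrite -(elliottCK g).
by have [_ SC _] := Scl; exact: SC.
Qed.

Lemma generator_coord g : elliott_generator g ->
  F g = (fun t => \val t) \/ F g = (fun t => 1 - \val t).
Proof.
move=> hg; have [i hi] := F_surj (@M1_id R) (@I01_bounds R).
apply: M1_injective => // s t gst; apply: val_inj.
pose S := [set x | F x s = F x t].
have : S i.
  rewrite (hg S) //; split; rewrite /S /=.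
  - by rewrite !F0.
  - by move=> x hx; rewrite !FC hx.
  - by move=> x y hx hy; rewrite !FD hx hy.
by rewrite /S /= hi.
Qed.

Lemma generator_neqC g : elliott_generator g -> elliottC g <> g.
Proof.
move=> /generator_coord hg /(congr1 (fun x => F x (pt 0))).
have p0 : \val (pt (0 : R)) = 0 by exact: val_pt.
rewrite FC => h; have : F g (pt 0) = 0 \/ F g (pt 0) = 1.
  by case: hg => ->; rewrite p0 ?subr0; [left|right].
by case=> hg'; move: h; rewrite hg' => /eqP; rewrite ?subr0 ?subrr ?oner_eq0// eq_sym oner_eq0.
Qed.

Lemma generator_eq g h : elliott_generator g -> elliott_generator h ->
  h = g \/ h = elliottC g.
Proof.
move=> /generator_coord hg /generator_coord hh.
have [hgh|ngh] := pselect (F h = F g); [by left; exact: F_inj|right].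
apply: F_ext => t; rewrite FC; case: hg hh ngh => -> [] -> // _.
by rewrite subKr.
Qed.

Lemma elliott_flip : exists2 s : elliott A -> elliott A,
  elliott_automorphism s & forall g, elliott_generator g -> s g = elliottC g.
Proof.
have h x : exists y, F y = fun t => F x (pt (1 - \val t)).
  by apply: F_surj => [|t]; [exact: M1_flip|exact: F_bounds].
have [s hs] := choice h.
have sE x t : F (s x) t = F x (pt (1 - \val t)) by rewrite hs.
have flipK (t : I01 R) : pt (1 - \val (pt (1 - \val t))) = t.
  rewrite val_pt; first by rewrite subKr pt_val.
    by rewrite subr_ge0 I01_le1.
  by rewrite gerBl I01_ge0.
have sK : involutive s by move=> x; apply: F_ext => t; rewrite !sE flipK.
exists s.
  split; first by exists s.
  - by apply: F_ext => t; rewrite sE !F0.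
  - by move=> x; apply: F_ext => t; rewrite sE !FC sE.
  - by move=> x y; apply: F_ext => t; rewrite sE !FD !sE.
move=> g /generator_coord hg; apply: F_ext => t; rewrite sE FC.
have vE : \val (pt (1 - \val t)) = 1 - \val t.
  by apply: val_pt; rewrite ?subr_ge0 ?I01_le1// gerBl I01_ge0.
by case: hg => ->; rewrite vE ?subKr.
Qed.

Lemma automorphism_id : elliott_automorphism (@id (elliott A)).
Proof. by split=> //; exists id. Qed.

Lemma automorphism_unique g (s s' : elliott A -> elliott A) : elliott_generator g ->
  elliott_automorphism s -> elliott_automorphism s' -> s g = s' g -> s = s'.
Proof.
move=> hg [_ s0 sC sD] [_ s'0 s'C s'D] sg; apply/funext => x.
have : [set y | s y = s' y] x; last by [].
rewrite (hg [set y | s y = s' y])//; split=> /=.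
- by rewrite s0 s'0.
- by move=> y hy; rewrite sC s'C hy.
- by move=> y z hy hz; rewrite sD s'D hy hz.
Qed.

Lemma other_generator p : mvn_class (prC p) = elliottC (mvn_class p) ->
  elliott_generator (mvn_class p) ->
  forall g, elliott_generator g /\ g <> mvn_class p <-> g = mvn_class (prC p).
Proof.
move=> pC hp g; rewrite pC; split=> [[hg gp]|->].
  by have [] := generator_eq hp hg.
by split; [exact: generatorC|exact: generator_neqC].
Qed.

Lemma automorphism_exists g h : elliott_generator g -> elliott_generator h ->
  exists! s : elliott A -> elliott A, elliott_automorphism s /\ s g = h.
Proof.
move=> hg hh.
have [s [sa sg]] : exists s : elliott A -> elliott A, elliott_automorphism s /\ s g = h.
  have [->|->] := generator_eq hg hh; first by exists id; split; first exact: automorphism_id.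
  by have [s sa sC] := elliott_flip; exists s; split; last exact: sC.
exists s; split=> // s' [s'a s'g]; apply: (automorphism_unique hg) => //.
by rewrite sg s'g.
Qed.

End Generators.

Theorem theorem3p2 (R : realType) (A : cstarAlgType R) (hA : is_farey_AF A) :
  (exists g : elliott A, elliott_generator g) /\
  (forall p q : projection A,
     elliott_generator (mvn_class p) -> elliott_generator (mvn_class q) ->
     exists! f : elliott A -> elliott A,
       elliott_automorphism f /\ f (mvn_class p) = mvn_class q) /\
  (forall p : projection A,
     elliott_generator (mvn_class p) ->
     forall g : elliott A,
       elliott_generator g /\ g <> mvn_class p <-> g = mvn_class (prC p)).
Proof.
have [[F [Ffd FS Fdense]] [phi [phiD phi_inj phi_range phi_pos phi1]]] := hA.
have cancel := AF_cancel Ffd FS Fdense.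
pose c := ecoord (phi := phi).
have c_inj : injective c by exact: ecoord_inj.
have c_M1 x : M1 R (c x) by exact: ecoord_M1.
have c_bounds x t : 0 <= c x t <= 1.
  by rewrite (ecoord_ge0 phi_pos) (ecoord_le1 phiD phi_pos phi1).
have c_surj f : M1 R f -> (forall t, 0 <= f t <= 1) -> exists x, c x = f.
  exact: ecoord_surj.
have c0 t : c (elliott0 A) t = 0 by exact: ecoord0.
have cC x t : c (elliottC x) t = 1 - c x t by exact: ecoordC.
have cD x y t : c (elliottD x y) t = Num.min (c x t + c y t) 1 by exact: ecoordD.
split.
  have [g hg] := c_surj _ (@M1_id R) (@I01_bounds R).
  by exists g; apply: (generator_id (F := c)).
split=> [p q hp hq|p hp].
  exact: (automorphism_exists (F := c)).
apply: (other_generator (F := c)) => //.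
exact: (mvn_class_prC cancel phiD phi_inj phi1).
Qed.
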